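(* Let $q$ be a prime power. Suppose we are given a positive integer $n\geq 1$, a smooth, proper, geometrically irreducible curve $X$ over $\mathbb{F}_q$ with function field $\kappa(X)$, and separable rational functions $u,v\in\kappa(X)$ satisfying the following conditions: (1) $\#X(\mathbb{F}_q)=n(q+1)$; (2) $u$ has degree $n(q+1)$ and $v$ has degree $n$; (3) $\kappa(X)=\mathbb{F}_q(u,v)$; and (4) $u$ vanishes at all points of $X(\mathbb{F}_q)$. Then $v$ generates a totally $u$-adic extension of $\mathbb{F}_q(u)$ of degree $n(q+1)$, and $h(v)=1/(q+1)$.
   Context: A rational function $w\in\kappa(X)$ is separable if it is nonconstant and $\kappa(X)/\mathbb{F}_q(w)$ is a separable extension; its degree is the degree of the associated morphism $X\to\mathbb{P}^1$, i.e. $[\kappa(X):\mathbb{F}_q(w)]$. Regard $u$ as an indeterminate over $\mathbb{F}_q$, so $\mathbb{F}_q(u)$ is a rational function field. That $v$ generates a totally $u$-adic extension of $\mathbb{F}_q(u)$ means that the minimal polynomial of $v$ over $\mathbb{F}_q(u)$ splits completely over the Laurent series field $\mathbb{F}_q((u))$. The height $h(v)$ is taken relative to $\mathbb{F}_q(u)$: $h(v)=\deg_u(f)/\deg_x(f)$, where $f\in\mathbb{F}_q[u][x]$ is the polynomial that is irreducible over $\mathbb{F}_q(u)$ as a polynomial in $x$, satisfies $f(v)=0$, has coefficients in $\mathbb{F}_q[u]$ with no common factor, and has leading coefficient (in $x$) monic in $u$. *)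

(* Defs.v *)
From HB Require Import structures.
From mathcomp Require Import all_boot all_order all_algebra separable.
From mathcomp Require Import boolp classical_sets functions cardinality mpoly.

Set Implicit Arguments.
Unset Strict Implicit.
Unset Printing Implicit Defensive.

Import GRing.Theory.
Local Open Scope classical_set_scope.
Local Open Scope ring_scope.

Section PowerSeries.
Variable F : fieldType.

(* A record, so as not to inherit the pointwise product of [nat -> F]. *)
Record powser := PowSer { pscoef : nat -> F }.

Lemma powserP (f g : powser) : pscoef f =1 pscoef g -> f = g.
Proof. by case: f g => f [g] /= /funext ->. Qed.

HB.instance Definition _ := gen_eqMixin powser.
HB.instance Definition _ := gen_choiceMixin powser.

Definition ps_add f g := PowSer (fun n => pscoef f n + pscoef g n).
Definition ps_opp f := PowSer (fun n => - pscoef f n).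
Definition ps_const c := PowSer (fun n => if n == 0%N then c else 0).
Definition ps_mul f g :=
  PowSer (fun n => \sum_(i < n.+1) pscoef f i * pscoef g (n - i)%N).

Lemma ps_addA : associative ps_add.
Proof. by move=> f g h; apply/powserP => n /=; rewrite addrA. Qed.
Lemma ps_addC : commutative ps_add.
Proof. by move=> f g; apply/powserP => n /=; rewrite addrC. Qed.
Lemma ps_add0 : left_id (ps_const 0) ps_add.
Proof. by move=> f; apply/powserP => n /=; rewrite if_same add0r. Qed.
Lemma ps_addN : left_inverse (ps_const 0) ps_opp ps_add.
Proof. by move=> f; apply/powserP => n /=; rewrite if_same addNr. Qed.

HB.instance Definition _ :=
  GRing.isZmodule.Build powser ps_addA ps_addC ps_add0 ps_addN.

(* The coefficients of index at most n of a product of series are those of the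
   product of the truncations. *)
Definition ps_trunc N f : {poly F} := \poly_(i < N) pscoef f i.

Lemma ps_mul_trunc N f g n : (n < N)%N ->
  pscoef (ps_mul f g) n = (ps_trunc N f * ps_trunc N g)`_n.
Proof.
move=> nN; rewrite coefM /=; apply: eq_bigr => i _; rewrite !coef_poly.
have le_in : (i <= n)%N by rewrite -ltnS.
by rewrite (leq_ltn_trans le_in nN) (leq_ltn_trans (leq_subr _ _) nN).
Qed.

Lemma ps_truncM N f g h n : (n < N)%N ->
  (ps_trunc N (ps_mul f g) * ps_trunc N h)`_n =
  (ps_trunc N f * ps_trunc N g * ps_trunc N h)`_n.
Proof.
move=> nN; rewrite !coefM; apply: eq_bigr => i _; congr (_ * _).
have iN : (i < N)%N by apply: leq_ltn_trans nN; rewrite -ltnS.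
by rewrite coef_poly iN (ps_mul_trunc _ _ iN).
Qed.

Lemma ps_mulC : commutative ps_mul.
Proof.
by move=> f g; apply/powserP => n; rewrite !(ps_mul_trunc _ _ (ltnSn n)) mulrC.
Qed.

Lemma ps_mulA : associative ps_mul.
Proof.
move=> f g h; apply/powserP => n.
rewrite [ps_mul f _]ps_mulC !(ps_mul_trunc _ _ (ltnSn n)).
by rewrite !ps_truncM // mulrC mulrA.
Qed.

Lemma ps_mul1 : left_id (ps_const 1) ps_mul.
Proof.
move=> f; apply/powserP => n /=.
by rewrite big_ord_recl big1 ?mul1r ?addr0 ?subn0 // => i _; rewrite mul0r.
Qed.

Lemma ps_mulDl : left_distributive ps_mul ps_add.
Proof.
move=> f g h; apply/powserP => n /=; rewrite -big_split /=.
by apply: eq_bigr => i _; rewrite mulrDl.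
Qed.

Lemma ps_1neq0 : ps_const 1 != 0.
Proof. by apply/eqP => /(congr1 (pscoef^~ 0%N))/eqP; rewrite oner_eq0. Qed.

HB.instance Definition _ := GRing.Zmodule_isComNzRing.Build powser
  ps_mulA ps_mulC ps_mul1 ps_mulDl ps_1neq0.

Definition ps_unit : pred powser := fun f => `[< exists g, g * f = 1 >].
Definition ps_inv (f : powser) : powser :=
  if ps_unit f then xget f [set g | g * f = 1] else f.

Lemma ps_mulV : {in ps_unit, left_inverse 1 ps_inv *%R}.
Proof.
move=> f uf; have uf' : ps_unit f by [].
rewrite /ps_inv uf'; case/asboolP: uf' => g gf.
by apply: (@xgetI _ _ [set h | h * f = 1] g).
Qed.
Lemma ps_unitPl (f g : powser) : g * f = 1 -> ps_unit f.
Proof. by move=> gf; apply/asboolP; exists g. Qed.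
Lemma ps_invr_out : {in [predC ps_unit], ps_inv =1 id}.
Proof. by move=> f /negPf uf; rewrite /ps_inv ifN // -[ps_unit f]/(f \in ps_unit) uf. Qed.

HB.instance Definition _ := GRing.ComNzRing_hasMulInverse.Build powser
  ps_mulV ps_unitPl ps_invr_out.

Lemma ps_neq0 (f : powser) : f != 0 ->
  exists2 n, pscoef f n != 0 & forall i, (i < n)%N -> pscoef f i = 0.
Proof.
move=> f0; have /ex_minnP[n fn n_min] : exists n, pscoef f n != 0.
  apply: contrapT => all0; case/eqP: f0; apply/powserP => n /=.
  by rewrite if_same; apply: contrapT => fn; apply: all0; exists n; apply/eqP.
by exists n => // i; apply: contraTeq; rewrite -leqNgt; apply: n_min.
Qed.

Lemma ps_idom (f g : powser) : f * g = 0 -> (f == 0) || (g == 0).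
Proof.
move=> fg0; apply: contraT; rewrite negb_or => /andP[].
case/ps_neq0=> a fa a_min /ps_neq0[b gb b_min].
have /eqP := congr1 (pscoef^~ (a + b)%N) fg0; rewrite /= if_same.
have aN : (a < (a + b).+1)%N by rewrite ltnS leq_addr.
rewrite (bigD1 (Ordinal aN)) //= addKn big1 ?addr0 ?mulf_eq0 ?(negPf fa) //=.
  by rewrite (negPf gb).
move=> i; rewrite -val_eqE /= neq_ltn => /orP[lt_ia|lt_ai].
  by rewrite a_min ?mul0r.
rewrite (b_min (a + b - i)%N) ?mulr0 // ltn_subLR ?ltn_add2r //.
by rewrite -ltnS.
Qed.

HB.instance Definition _ := GRing.ComUnitRing_isIntegral.Build powser ps_idom.

Definition laurent := {fraction powser}.

Definition powser_of_poly (p : {poly F}) : powser := PowSer (fun n => p`_n).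

Lemma powser_of_poly_zmod_morphism : zmod_morphism powser_of_poly.
Proof. by move=> p r; apply/powserP => n /=; rewrite coefB. Qed.
Lemma powser_of_poly_monoid_morphism : monoid_morphism powser_of_poly.
Proof.
split=> [|p r]; apply/powserP => n /=; first by rewrite coef1; case: eqP.
by rewrite coefM.
Qed.
HB.instance Definition _ := GRing.isZmodMorphism.Build {poly F} powser
  powser_of_poly powser_of_poly_zmod_morphism.
HB.instance Definition _ := GRing.isMonoidMorphism.Build {poly F} powser
  powser_of_poly powser_of_poly_monoid_morphism.

Lemma powser_of_poly_inj : injective powser_of_poly.
Proof. by move=> p r e; apply/polyP => i; apply: (congr1 (pscoef^~ i) e). Qed.

End PowerSeries.

(* The extension to {fraction R} of an injective ring morphism R -> L. *)
Definition frac_ext (R : idomainType) (L : fieldType) (phi : R -> L)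
    (r : {fraction R}) : L := phi \n_(repr r) / phi \d_(repr r).

Lemma frac_repr (R : idomainType) (r : {fraction R}) :
  r = tofrac \n_(repr r) / tofrac \d_(repr r).
Proof.
set s := repr r; have d0 : \d_s != 0 := denom_ratioP s.
apply: (canRL (mulfK _)); first by rewrite tofrac_eq0.
rewrite -[r]reprK -/s -[_ * _]/(FracField.mul _ _) !piE.
apply/eqmodP; rewrite /= FracField.equivfE /FracField.mulf.
by rewrite !numden_Ratio ?mulf_neq0 ?oner_neq0 //= !mulr1 mulrC.
Qed.

Lemma frac_extE (R : idomainType) (L : fieldType) (phi : {rmorphism R -> L}) :
  injective phi ->
  forall x y, y != 0 -> frac_ext phi (tofrac x / tofrac y) = phi x / phi y.
Proof.
move=> phi_inj x y y0; rewrite /frac_ext.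
have /eqP := frac_repr (tofrac x / tofrac y).
set s := repr _; have d0 : \d_s != 0 := denom_ratioP s.
rewrite eqr_div ?tofrac_eq0 // -!rmorphM tofrac_eq => /eqP e.
by apply/eqP; rewrite eqr_div -?(rmorph0 phi) ?(inj_eq phi_inj) // -!rmorphM e.
Qed.

Notation ratfun F := {fraction {poly F}}.

Definition laurent_of_ratfun (F : fieldType) : ratfun F -> laurent F :=
  frac_ext (fun p : {poly F} => tofrac (powser_of_poly p)).

(* Subfields of K are represented by their sets of elements. *)
Section Subfields.
Variable K : fieldType.
Implicit Types (E L : set K) (p : {poly K}).

Definition over E p := forall i, E p`_i.

Definition is_minpoly E (x : K) p :=
  [/\ p \is monic, over E p, root p x &
      forall r, over E r -> r != 0 -> root r x -> (size p <= size r)%N].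

Definition is_algebraic E (x : K) := exists2 p, over E p & p != 0 /\ root p x.

Definition is_separable E :=
  forall x : K, exists2 p, is_minpoly E x p & separable_poly p.

(* [L : E] = d, witnessed by a basis *)
Definition ext_degree E L (d : nat) :=
  exists2 b : 'I_d -> K, forall i, L (b i) &
    forall x, L x -> exists! c : {ffun 'I_d -> K},
      (forall i, E (c i)) /\ x = \sum_i c i * b i.

End Subfields.

(* An integral separated scheme of finite type over k with function field K is
   determined by the set of its local rings, viewed as subrings of K (a "model"
   in the sense of Zariski, a "schema" in the sense of Chevalley, cf. EGA I, 8).
   A point of the scheme is thus represented by its local ring O : set K. *)

Section Models.
Variables (k K : fieldType) (cst : {rmorphism k -> K}).
Implicit Types (O V A P : set K) (X : set (set K)).

Definition mev m (a : m.-tuple K) (p : {mpoly k[m]}) : K := mmap cst (tnth a) p.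

(* k[a_1, ..., a_m] and k(a_1, ..., a_m) *)
Definition gen_alg m (a : m.-tuple K) : set K := [set mev a p | p in setT].
Definition gen_field m (a : m.-tuple K) : set K :=
  [set z | exists p s, mev a s != 0 /\ z = mev a p / mev a s].

Definition prime_ideal A P :=
  [/\ P `<=` A, P 0 & ~ P 1] /\
  [/\ forall x y, P x -> P y -> P (x + y),
      forall x y, A x -> P y -> P (x * y) &
      forall x y, A x -> A y -> P (x * y) -> P x \/ P y].

Definition localization A P : set K :=
  [set z | exists x s, [/\ A x, A s, ~ P s & z = x / s]].

(* the local rings of Spec k[a] *)
Definition Spec m (a : m.-tuple K) : set (set K) :=
  [set O | exists2 P, prime_ideal (gen_alg a) P &
                      O = localization (gen_alg a) P].

Definition affine_open X m (a : m.-tuple K) :=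
  gen_field a = setT /\ Spec a `<=` X.

Definition unit_in O : set K := [set x | O x /\ exists2 y, O y & x * y = 1].
Definition max_ideal O : set K := O `\` unit_in O.

Definition valuation_ring V :=
  [/\ forall c, V (cst c), forall x y, V x -> V y -> V (x - y),
      forall x y, V x -> V y -> V (x * y) & forall x, V x \/ V x^-1].

Definition dominates V O := O `<=` V /\ max_ideal O `<=` max_ideal V.

End Models.

(* An integral curve: one-dimensional, separated, of finite type over k.  The
   points include the generic point, whose local ring is the function field.
   Separatedness is expressed by the valuative criterion. *)
Record curve (k : fieldType) := Curve {
  function_field : fieldType;
  cst : {rmorphism k -> function_field};
  points : set (set function_field);
  curve_finite_type :
    exists (r : nat) (m : 'I_r.+1 -> nat)
           (a : forall i, (m i).-tuple function_field),
      (forall i, affine_open cst points (a i)) /\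
      points = \bigcup_(i in setT) Spec cst (a i);
  curve_separated :
    forall V, valuation_ring cst V ->
    forall O O', points O -> points O' ->
      dominates V O -> dominates V O' -> O = O';
  curve_trdeg1 :
    exists2 t, ~ algebraicOver cst t &
      forall x, is_algebraic (gen_field cst [tuple t]) x }.

Notation "'κ' ( X )" := (function_field X) (format "'κ' ( X )").

Section CurveProperties.
Variables (k : fieldType) (X : curve k).
Local Notation ev := (mev (cst X)).

(* Valuative criterion; the uniqueness half is [curve_separated]. *)
Definition proper_curve :=
  forall V, valuation_ring (cst X) V -> exists2 O, points O & dominates V O.

(* Jacobian criterion of smoothness of relative dimension 1 at the point O of
   Spec k[a_0, ..., a_m]: some m relations among the a_i have an m x m minor of
   their Jacobian matrix that does not vanish at the point. *)
Definition smooth_at (O : set κ(X)) :=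
  exists (m : nat) (a : m.+1.-tuple κ(X)) (G : 'I_m -> {mpoly k[m.+1]})
         (s : 'I_m -> 'I_m.+1),
    [/\ Spec (cst X) a O, forall j, ev a (G j) = 0 &
        unit_in O (\det (\matrix_(j, l) ev a (G j)^`M(s l)))].

Definition smooth_curve := forall O : set κ(X), points O -> smooth_at O.

(* The ideal of L[x_1, ..., x_m] generated by the relations among the a_i, whose
   quotient ring is L ⊗ k[a]. *)
Definition base_change_ideal (L : fieldType) (j : {rmorphism k -> L}) m
    (a : m.-tuple κ(X)) : set {mpoly L[m]} :=
  [set f | exists r (G : 'I_r -> {mpoly k[m]}) (h : 'I_r -> {mpoly L[m]}),
     (forall i, ev a (G i) = 0) /\ f = \sum_i h i * map_mpoly j (G i)].

(* X_L is irreducible for every extension L of k.  The affine opens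
   Spec (L ⊗ k[a]) cover X_L and are nonempty, and any two of them meet because X
   is irreducible, so X_L is irreducible iff each of them is, i.e., iff the
   nilradical of each L ⊗ k[a] is prime. *)
Definition geometrically_irreducible :=
  forall (L : fieldType) (j : {rmorphism k -> L}) m (a : m.-tuple κ(X)),
  affine_open (cst X) (points (c := X)) a ->
  let I := base_change_ideal j a in
  forall f g, (exists e, I ((f * g) ^+ e)) ->
    (exists e, I (f ^+ e)) \/ (exists e, I (g ^+ e)).

(* X(k): the points with residue field k *)
Definition rational_points : set (set κ(X)) :=
  [set O | points O /\
           forall x, O x -> exists c, max_ideal O (x - cst X c)].

Definition vanishes_at (w : κ(X)) (O : set κ(X)) := max_ideal O w.

Definition separable_function (w : κ(X)) :=
  ~ (exists c, w = cst X c) /\ is_separable (gen_field (cst X) [tuple w]).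

Definition function_degree (w : κ(X)) (d : nat) :=
  ext_degree (gen_field (cst X) [tuple w]) setT d.

Variables u v : κ(X).

Definition poly_at (p : {poly k}) : κ(X) := (map_poly (cst X) p).[u].
(* meaningful when u is transcendental over k, see [frac_extE] *)
Definition ratfun_at : ratfun k -> κ(X) := frac_ext poly_at.

(* mu is the minimal polynomial of v over k(u), with coefficients in the
   abstract rational function field. *)
Definition totally_adic :=
  exists2 mu : {poly ratfun k},
    is_minpoly (gen_field (cst X) [tuple u]) v (map_poly ratfun_at mu) &
    exists rs : seq (laurent k),
      map_poly (@laurent_of_ratfun k) mu = \prod_(z <- rs) ('X - z%:P).

(* {poly {poly k}} stands for k[u][x]: the outer variable is x. *)
Definition height_poly (f : {poly {poly k}}) :=
  [/\ irreducible_poly (map_poly (@tofrac {poly k}) f),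
      (map_poly poly_at f).[v] = 0,
      forall d : {poly k}, (forall i, d %| f`_i) -> size d = 1%N &
      lead_coef f \is monic].

Definition deg_x (f : {poly {poly k}}) : nat := (size f).-1.
Definition deg_u (f : {poly {poly k}}) : nat :=
  \max_(i < size f) (size (f`_i)%R).-1.

(* f is unique when it exists. *)
Definition height : rat :=
  let f := xget 0 [set f | height_poly f] in (deg_u f)%:R / (deg_x f)%:R.

End CurveProperties.

Arguments rational_points [k] X.
Arguments proper_curve [k] X.
Arguments smooth_curve [k] X.
Arguments geometrically_irreducible [k] X.

(* Main.v *)
Require Import Defs.
From mathcomp Require Import all_boot all_order all_algebra.
From mathcomp Require Import classical_sets cardinality.
From HB Require Import structures.
From mathcomp Require Import perm finfield ring boolp mpoly.

(** Write k for the field with q elements and put N = n(q+1). The N rational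
points of X are zeros of u, and u has degree N, so they exhaust the fibre of u
over 0 and each of them is a simple zero. Hence u is a uniformizer at every
rational point, the completion there is k((u)), and expansion in powers of u
embeds the function field in k((u)) over k(u). The N embeddings differ,
because an embedding recovers the local ring of its point, and since k(X) =
k(u,v) they already differ at v. The images of v are thus N distinct roots in
k((u)) of the minimal polynomial of v over k(u), whose degree is N, so that
polynomial splits.

For the height, let f in k[u][x] be primitive with f(u,v) = 0 and irreducible
over k(u).  By Gauss's lemma f divides every polynomial relation between u and
v, so it has both the least degree in x, which is [k(X):k(u)] = N, and the
least degree in u, which is [k(X):k(v)] = n.  The height is n/N.

The local rings are handled by elementary means.
- [Jacobian_uniformizer]: the Jacobian criterion makes the maximal ideal of a
  rational point principal, by a first-order Taylor formula and Cramer's rule.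
- [principal_uniformizer]: every nonzero element is a unit times a power of
  the generator.  This replaces Krull's intersection theorem by the remark that
  any two elements of the function field satisfy a polynomial relation.
- [full_fiber_unramified]: if u were not a uniformizer at some point, one could
  write down N+1 functions independent over k(u).  Separating the points takes
  no induction here, because x^q - x + 1 has no zero in the residue field k and
  so tests in all the local rings at once whether x has a pole.
- [Laurent_expansion]: the embedding in k((u)), and how it recovers the ring.
- [small_relation] and [relation_size]: when k(X) = k(u,v), the least degree in
  v of a relation between u and v is [k(X):k(u)].
- [primitive_divides]: the form of Gauss's lemma used for the height. *)

Set Implicit Arguments.
Unset Strict Implicit.
Unset Printing Implicit Defensive.

Import GRing.Theory.
Local Open Scope classical_set_scope.
Local Open Scope ring_scope.

(** * Local rings with residue field k *)

Lemma mpoly_ring_ind (R : comNzRingType) m (P : {mpoly R[m]} -> Prop) :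
  (forall c, P c%:MP) -> (forall i, P 'X_i) ->
  (forall p r, P p -> P r -> P (p + r)) ->
  (forall p r, P p -> P r -> P (p * r)) -> forall p, P p.
Proof.
move=> PC PX PD PM p; rewrite [p]mpolyE; apply: big_ind => //.
  by rewrite -mpolyC0; apply: PC.
move=> e _; rewrite -mul_mpolyC; apply: (PM) => //.
have P1 : P 1 by rewrite -mpolyC1; apply: PC.
rewrite mpolyXE_id; apply: big_ind => [//|//|i _]; move: (e i).
by elim=> [|j IHj]; rewrite ?expr0 // exprS; apply: PM.
Qed.

Section LocalRings.
Variables (k K : fieldType) (cst : {rmorphism k -> K}).
Implicit Types (O : set K) (x y z : K).

Lemma mevD m (a : m.-tuple K) p r :
  mev cst a (p + r) = mev cst a p + mev cst a r.
Proof. exact: mmapD. Qed.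

Lemma mevM m (a : m.-tuple K) p r :
  mev cst a (p * r) = mev cst a p * mev cst a r.
Proof. by rewrite /mev; case: (mmap_is_multiplicative (tnth a) cst) => + _; apply. Qed.

Lemma mevC m (a : m.-tuple K) c : mev cst a c%:MP = cst c.
Proof. exact: mmapC. Qed.

Lemma mevX m (a : m.-tuple K) i : mev cst a 'X_i = tnth a i.
Proof. by rewrite /mev mmapX mmap1U. Qed.

(** A local k-algebra with residue field k inside a field: it is the closure of
the nonunits under addition that makes the ring local. *)
Record rational_local_ring O : Prop := RationalLocalRing {
  local_cst : forall c, O (cst c);
  localB : forall x y, O x -> O y -> O (x - y);
  localM : forall x y, O x -> O y -> O (x * y);
  max_idealD : forall x y,
    max_ideal O x -> max_ideal O y -> max_ideal O (x + y);
  local_residue : forall x, O x -> exists c, max_ideal O (x - cst c) }.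

(** The nonunits of a localization at P are the fractions with numerator in P,
so they are closed under addition. *)
Lemma Spec_local m (a : m.-tuple K) O :
  Spec cst a O -> (forall x, O x -> exists c, max_ideal O (x - cst c)) ->
  rational_local_ring O.
Proof.
case=> P [[PA P0 P1] [PD PMl Pp]] -> res.
set A := gen_alg cst a in P PA P0 P1 PD PMl Pp res *.
set O' := localization A P in res *.
have AC c : A (cst c) by exists c%:MP => //; rewrite mevC.
have AD x y : A x -> A y -> A (x + y).
  by move=> [p _ <-] [r _ <-]; exists (p + r) => //; rewrite mevD.
have AM x y : A x -> A y -> A (x * y).
  by move=> [p _ <-] [r _ <-]; exists (p * r) => //; rewrite mevM.
have AN x : A x -> A (- x).
  by move=> Ax; rewrite -mulN1r -(rmorph1 cst) -rmorphN; apply: AM.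
have s0 s : ~ P s -> s != 0 by move=> Ps; apply/eqP => s0; apply: Ps; rewrite s0.
have PsM s r : A s -> A r -> ~ P s -> ~ P r -> ~ P (s * r).
  by move=> As Ar Ps Pr /(Pp _ _ As Ar)[].
have maxP z : max_ideal O' z <-> exists x s, [/\ P x, A s, ~ P s & z = x / s].
  split=> [[[x [s [Ax As Ps ->]]] nu]|[x [s [Px As Ps ->]]]].
    exists x, s; split=> //; apply: contrapT => nPx; apply: nu; split.
      by exists x, s.
    exists (s / x); first by exists s, x.
    by field; rewrite !s0.
  split; first by exists x, s; split=> //; apply: PA.
  case=> _ [_ [y [r [Ay Ar Pr ->]]]] /eqP.
  rewrite mulf_div -(inj_eq (mulIf (mulf_neq0 (s0 _ Ps) (s0 _ Pr)))).
  rewrite mulfVK ?mulf_neq0 ?s0 // mul1r => /eqP e.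
  by apply: (PsM _ _ As Ar Ps Pr); rewrite -e mulrC; apply: PMl.
split=> //.
- move=> c; exists (cst c), 1; split=> //; last by rewrite divr1.
  by rewrite -(rmorph1 cst).
- move=> _ _ [x [s [Ax As Ps ->]]] [y [r [Ay Ar Pr ->]]].
  exists (x * r - y * s), (s * r); split.
  + by apply: AD; [apply: AM | apply: AN; apply: AM].
  + exact: AM.
  + exact: PsM.
  + by field; rewrite !s0.
- move=> _ _ [x [s [Ax As Ps ->]]] [y [r [Ay Ar Pr ->]]].
  by exists (x * y), (s * r); split; [apply: AM | apply: AM | apply: PsM | rewrite mulf_div].
- move=> x0 y0 /maxP[x [s [Px As Ps ->]]] /maxP[y [r [Py Ar Pr ->]]]; apply/maxP.
  exists (r * x + s * y), (s * r); split.
  + by apply: PD; apply: PMl.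
  + exact: AM.
  + exact: PsM.
  + by field; rewrite !s0.
Qed.

Lemma Spec_gen_alg m (a : m.-tuple K) O : Spec cst a O -> gen_alg cst a `<=` O.
Proof.
move=> [P [[PA P0 P1] _] ->] x Ax; exists x, 1; split=> //; last by rewrite divr1.
by exists 1%:MP => //; rewrite mevC rmorph1.
Qed.

Section Basics.
Variable O : set K.
Hypothesis HO : rational_local_ring O.
Local Notation m := (max_ideal O).

Lemma max_ideal_sub x : m x -> O x. Proof. by case. Qed.

Lemma local0 : O 0. Proof. by rewrite -(rmorph0 cst); apply: local_cst. Qed.
Lemma local1 : O 1. Proof. by rewrite -(rmorph1 cst); apply: local_cst. Qed.
Lemma localN x : O x -> O (- x).
Proof. by move=> Ox; rewrite -sub0r; apply: (localB HO) => //; apply: local0. Qed.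
Lemma localD x y : O x -> O y -> O (x + y).
Proof. by move=> Ox Oy; rewrite -[y]opprK; apply: (localB HO) => //; apply: localN. Qed.
Lemma localX x n : O x -> O (x ^+ n).
Proof.
by move=> Ox; elim: n => [|n IHn]; rewrite ?exprS; [apply: local1 | apply: (localM HO)].
Qed.
Lemma local_sum I (r : seq I) (P : pred I) (f : I -> K) :
  (forall i, P i -> O (f i)) -> O (\sum_(i <- r | P i) f i).
Proof.
by move=> Of; apply: big_ind => //; [apply: local0 | apply: localD].
Qed.

Lemma max_ideal_not1 : ~ m 1.
Proof. by case=> O1 []; split=> //; exists 1; rewrite ?mulr1. Qed.

Lemma local_unit x : O x -> ~ m x -> x != 0 /\ O x^-1.
Proof.
move=> Ox mx; have [_ [y Oy xy]] : unit_in O x by apply: contrapT => nu; apply: mx.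
have x0 : x != 0 by apply: contra_eq_neq xy => ->; rewrite mul0r eq_sym oner_neq0.
by split=> //; rewrite -[x^-1]mulr1 -xy mulKf.
Qed.

Lemma max_idealM x y : O x -> m y -> m (x * y).
Proof.
move=> Ox [Oy nu]; split; first exact: localM.
case=> _ [z Oz e]; apply: nu; split=> //; exists (x * z); first exact: localM.
by rewrite mulrCA mulrA.
Qed.

Lemma max_ideal_inv x : O x^-1 -> x != 0 -> ~ m x.
Proof.
by move=> Ox' x0 mx; apply: max_ideal_not1; rewrite -(mulVf x0); apply: max_idealM.
Qed.

Lemma max_ideal0 : m 0.
Proof.
split; first exact: local0.
by case=> _ [y _ /eqP]; rewrite mul0r eq_sym oner_eq0.
Qed.

Lemma max_idealN x : m x -> m (- x).
Proof.
by move=> mx; rewrite -mulN1r; apply: max_idealM => //; apply/localN/local1.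
Qed.

Lemma max_idealB x y : m x -> m y -> m (x - y).
Proof. by move=> mx my; apply: (max_idealD HO) => //; apply: max_idealN. Qed.

Lemma max_ideal_sum I (r : seq I) (P : pred I) (f : I -> K) :
  (forall i, P i -> m (f i)) -> m (\sum_(i <- r | P i) f i).
Proof.
by move=> mf; apply: big_ind => //; [apply: max_ideal0 | apply: (max_idealD HO)].
Qed.

Lemma max_ideal_cst c : m (cst c) -> c = 0.
Proof.
move=> mc; apply: contrapT => /eqP c0; move: mc; apply: max_ideal_inv.
  by rewrite -fmorphV; apply: local_cst.
by rewrite fmorph_eq0.
Qed.

Lemma local_unit_cong x y : ~ m x -> m (x - y) -> ~ m y.
Proof. by move=> nx xy my; apply: nx; rewrite -[x](subrK y); apply: (max_idealD HO). Qed.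

Lemma max_ideal_prime x y : O x -> O y -> m (x * y) -> m x \/ m y.
Proof.
move=> Ox Oy mxy; apply: contrapT => /not_orP[/(local_unit Ox)[x0 Ox'] []].
by rewrite -[y](mulKf x0); apply: max_idealM.
Qed.

Lemma local_det n (A : 'M[K]_n) : (forall i j, O (A i j)) -> O (\det A).
Proof.
move=> OA; apply: local_sum => s _; apply: (localM HO).
  by apply: localX; apply/localN/local1.
by apply: big_ind => //; [apply: local1 | apply: (localM HO)].
Qed.

(** Stands for the reduction of a determinant modulo the maximal ideal: O is
only a set, so there is no residue morphism to apply to matrices. *)
Lemma det_cong n (A B : 'M[K]_n) :
  (forall i j, O (A i j)) -> (forall i j, m (B i j)) ->
  m (\det A - \det (A - B)).
Proof.
move=> OA mB; rewrite -sumrB; apply: max_ideal_sum => s _.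
rewrite -mulrBr; apply: max_idealM.
  by apply: localX; apply/localN/local1.
have: O (\prod_i A i (s i)) /\ m (\prod_i A i (s i) - \prod_i (A - B) i (s i)).
  pose R x y := O x /\ m (x - y).
  apply: (big_ind2 R).
  - by split; [apply: local1 | rewrite subrr; apply: max_ideal0].
  - move=> x1 x2 y1 y2 [Ox xy] [Oy yz]; split; first exact: localM.
    have -> : x1 * y1 - x2 * y2 = x1 * (y1 - y2) + y2 * (x1 - x2) by ring.
    apply: (max_idealD HO); apply: max_idealM => //.
    by rewrite -[y2](subKr y1); apply: (localB HO) => //; apply: max_ideal_sub.
  - by move=> i _; split=> //; rewrite !mxE opprB addrC subrK.
by case.
Qed.

End Basics.

Section Taylor.
Variable O : set K.
Hypothesis HO : rational_local_ring O.
Local Notation m := (max_ideal O).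
Variables (d : nat) (a : d.-tuple K) (c : 'I_d -> k).
Hypothesis Oa : gen_alg cst a `<=` O.
Hypothesis ac : forall j, m (tnth a j - cst (c j)).

Local Notation x j := (tnth a j - cst (c j)).

(** The remainder has its coefficients r in the maximal ideal, so modulo the
square of that ideal a relation among the coordinates is a linear one, whose
coefficients are a row of the Jacobian matrix.  Such expansions are stable
under sums and products, and the product rule for the gradient is what makes
the linear terms match. *)
Lemma first_order_Taylor p : exists r : 'I_d -> K, (forall j, m (r j)) /\
  mev cst a p = cst p.@[c] + \sum_j (mev cst a p^`M(j) + r j) * x j.
Proof.
have Om s : O (mev cst a s) by apply: Oa; exists s.
elim/mpoly_ring_ind: p => [e|i|p s [f [mf ef]] [g [mg eg]]|p s [f [mf ef]] [g [mg eg]]].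
- exists (fun=> 0); split=> [j|]; first exact: max_ideal0.
  rewrite mevC mevalC big1 ?addr0 // => j _.
  by rewrite mderivC -mpolyC0 mevC rmorph0 add0r mul0r.
- exists (fun=> 0); split=> [j|]; first exact: max_ideal0.
  rewrite mevX mevalXU (bigD1 i) //= big1 ?addr0 => [|j /negPf ji].
    have -> : 'X_i^`M(i) = 1 :> {mpoly k[d]}.
      rewrite mderivX mnm1E eqxx -mpolyX0 scale1r; congr 'X_[_].
      by apply/mnmP => l; rewrite mnmBE mnm0E subnn.
    by rewrite -mpolyC1 mevC rmorph1; ring.
  by rewrite mderivX mnm1E eq_sym ji scale0r -mpolyC0 mevC rmorph0 add0r mul0r.
- exists (fun j => f j + g j); split=> [j|]; first exact: max_idealD.
  rewrite mevD mevalD rmorphD /= ef eg addrACA -big_split /=.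
  by congr (_ + _); apply: eq_bigr => j _; rewrite mderivD mevD; ring.
- pose dp := mev cst a p - cst p.@[c].
  have mdp : m dp.
    rewrite /dp ef addrC addKr; apply: (max_ideal_sum HO) => // j _.
    apply: (max_idealM HO) => //; apply: (localD HO) => //; exact: max_ideal_sub.
  exists (fun j => f j * mev cst a s + cst p.@[c] * g j
                 - dp * mev cst a s^`M(j)); split=> [j|].
    apply: (max_idealB HO) => //; last by rewrite mulrC; apply: (max_idealM HO).
    apply: (max_idealD HO) => //; last exact: max_idealM (local_cst HO _) _.
    by rewrite mulrC; apply: (max_idealM HO).
  pose Df := \sum_j (mev cst a p^`M(j) + f j) * x j.
  pose Dg := \sum_j (mev cst a s^`M(j) + g j) * x j.
  have -> : \sum_j (mev cst a (p * s)^`M(j) + (f j * mev cst a s + cst p.@[c] * g j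
      - dp * mev cst a s^`M(j))) * x j = mev cst a s * Df + cst p.@[c] * Dg.
    rewrite !mulr_sumr -big_split /=; apply: eq_bigr => j _.
    by rewrite mderivM mevD !mevM /dp; ring.
  rewrite mevM mevalM rmorphM /=.
  have -> : Df = mev cst a p - cst p.@[c] by rewrite /Df ef addrC addKr.
  have -> : Dg = mev cst a s - cst s.@[c] by rewrite /Dg eg addrC addKr.
  by ring.
Qed.

End Taylor.
End LocalRings.

(** An m x m minor of a matrix with m+1 columns leaves out one column: the
coordinate that it leaves out will be the uniformizer. *)
Lemma sum_missing_index (V : nmodType) d (s : 'I_d -> 'I_d.+1) :
  injective s -> exists2 l0, (forall i, i = l0 \/ exists l, i = s l) &
  forall f : 'I_d.+1 -> V, \sum_i f i = f l0 + \sum_l f (s l).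
Proof.
move=> s_inj.
have [l0 l0s] : exists l0, l0 \notin codom s.
  apply: contrapT => all_s; have := card_codom s_inj; rewrite card_ord => e.
  have : (#|'I_d.+1| <= #|codom s|)%N.
    apply: subset_leq_card; apply/fintype.subsetP => i _; apply: contrapT => /negP is_.
    by apply: all_s; exists i.
  by rewrite e card_ord ltnn.
have u1 : uniq (l0 :: codom s) by rewrite /= l0s map_inj_uniq ?enum_uniq.
have [_ e] : (size (l0 :: codom s) = size (enum 'I_d.+1)) *
             (l0 :: codom s =i enum 'I_d.+1).
  apply: uniq_min_size => // [i _|]; first by rewrite mem_enum.
  by rewrite /= size_codom -!cardE !card_ord.
exists l0 => [i|f].
  have : i \in l0 :: codom s by rewrite e mem_enum.
  by rewrite inE => /orP[/eqP|/codomP]; [left | right].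
rewrite -big_enum /= -(perm_big _ (uniq_perm u1 (enum_uniq _) e)) big_cons.
by rewrite big_image.
Qed.

Section Uniformizer.
Variables (k K : fieldType) (cst : {rmorphism k -> K}) (O : set K).
Hypothesis HO : rational_local_ring cst O.
Local Notation m := (max_ideal O).

(** Write x_j = a_j - c_j, with c the coordinates of the point.  The relations
G say that (J - R) x' is a multiple of the omitted coordinate, where x' lists
the other coordinates, J is the Jacobian minor and R has entries in the maximal
ideal.  As det (J - R) is a unit, Cramer's rule makes all the x_j multiples of
the omitted one; this is Nakayama's lemma made explicit. *)
Lemma Jacobian_uniformizer d (a : d.+1.-tuple K) (G : 'I_d -> {mpoly k[d.+1]})
    (s : 'I_d -> 'I_d.+1) :
  Spec cst a O -> (forall j, mev cst a (G j) = 0) ->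
  unit_in O (\det (\matrix_(j, l) mev cst a (G j)^`M(s l))) ->
  exists2 t, m t & forall x, m x -> exists2 y, O y & x = t * y.
Proof.
move=> SO G0 [OJ [dinv Odinv dJ]]; have Oa := Spec_gen_alg SO.
have A1 : gen_alg cst a 1 by exists 1%:MP => //; rewrite mevC rmorph1.
have [P [[PA P0 P1] _] OE] := SO.
have Om p : O (mev cst a p) by apply: Oa; exists p.
have /choice[c ac] : forall j, exists c, m (tnth a j - cst c).
  by move=> j; apply: (local_residue HO); rewrite -(mevX cst); apply: Om.
pose x j := tnth a j - cst (c j).
(* A function that vanishes at the point has no constant term. *)
have Taylor p : m (mev cst a p) -> exists2 r : 'I_d.+1 -> K, (forall j, m (r j)) &
    mev cst a p = \sum_j (mev cst a p^`M(j) + r j) * x j.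
  move=> mp; have [r [mr e]] := first_order_Taylor HO Oa ac p.
  exists r => //; rewrite e (_ : p.@[c] = 0) ?rmorph0 ?add0r //.
  apply: (max_ideal_cst HO); rewrite -(addrK (\sum_j (mev cst a p^`M(j) + r j) * x j)
    (cst p.@[c])) -[X in X - _]e.
  apply: (max_idealB HO) => //; apply: (max_ideal_sum HO) => j _.
  by apply: (max_idealM HO) (ac j); apply: (localD HO) => //; case: (mr j).
set J := \matrix_(_, _) _ in OJ dJ.
have nJ : ~ m (\det J) by case=> _ []; split=> //; exists dinv.
have s_inj : injective s.
  move=> l1 l2 e; apply: contrapT => /eqP l12; apply: nJ.
  rewrite -det_tr (determinant_alternate l12); first exact: (max_ideal0 HO).
  by move=> j; rewrite !mxE e.
have /choice[r Gr] : forall j, exists r : 'I_d.+1 -> K, (forall i, m (r i)) /\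
    \sum_i (mev cst a (G j)^`M(i) + r i) * x i = 0.
  move=> j; have mGj : m (mev cst a (G j)) by rewrite G0; apply: (max_ideal0 HO).
  have [r mr e] := Taylor _ mGj.
  by exists r; split=> //; rewrite -e.
have [l0 l0P sumE] := sum_missing_index K s_inj.
pose R := \matrix_(j, l) - r j (s l).
pose B : 'M_d := J - R.
have mR j l : m (R j l) by rewrite mxE; apply: (max_idealN HO); apply: (Gr j).1.
have OJjl j l : O (J j l) by rewrite mxE.
have OB j l : O (B j l).
  by rewrite 2!mxE; apply: (localD HO) => //; rewrite mxE; apply: (localN HO); case: (mR j l).
have OdB : O (\det B) by apply: (local_det HO).
have nB : ~ m (\det B) by apply: (local_unit_cong HO nJ); apply: (det_cong HO).
have [dB0 OdBV] := local_unit OdB nB.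
pose b := \col_j - (mev cst a (G j)^`M(l0) + r j l0) : 'cV[K]_d.
have Ob j : O (b j ord0).
  rewrite mxE; apply: (localN HO); apply: (localD HO) => //; apply: max_ideal_sub.
  exact: (Gr j).1.
have BX : B *m (\col_l x (s l)) = x l0 *: b.
  apply/colP => j; rewrite !mxE.
  have e := sumE (fun i => (mev cst a (G j)^`M(i) + r j i) * x i).
  rewrite (Gr j).2 in e.
  have -> : \sum_l B j l * (\col_l0 x (s l0)) l ord0 =
    \sum_l (mev cst a (G j)^`M(s l) + r j (s l)) * x (s l).
    by apply: eq_bigr => l _; rewrite !mxE opprK.
  transitivity (- ((mev cst a (G j)^`M(l0) + r j l0) * x l0)); last by ring.
  by apply/eqP; rewrite -addr_eq0 addrC -e.
exists (x l0); first exact: ac.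
have tx i : exists2 y, O y & x i = x l0 * y.
  case: (l0P i) => [->|[l ->]]; first by exists 1; rewrite ?mulr1 //; apply: (local1 HO).
  exists ((\det B)^-1 * (\adj B *m b) l ord0).
    apply: (localM HO) => //; rewrite mxE; apply: (local_sum HO) => j _.
    apply: (localM HO) => //; rewrite mxE; apply: (localM HO).
      by apply: (localX HO); apply/(localN HO)/(local1 HO).
    by apply: (local_det HO) => i1 i2; rewrite 2!mxE; apply: OB.
  have := congr1 (mulmx (\adj B)) BX; rewrite mulmxA mul_adj_mx mul_scalar_mx -scalemxAr.
  move/colP/(_ l); rewrite !mxE => e.
  by apply: (mulfI dB0); rewrite e; field.
move=> z mz; have Oz : O z by case: mz.
move: (Oz); rewrite {1}OE => -[_ [w [[p _ <-] Aw Pw ez]]].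
have w0 : w != 0 by apply/eqP => w0; apply: Pw; rewrite w0.
have Ow' : O w^-1 by rewrite OE; exists 1, w; rewrite div1r.
have [|r1 mr1 e] := Taylor p.
  by rewrite -[mev _ _ _](divfK w0) -ez mulrC; apply: (max_idealM HO) => //; apply: Oa.
have /choice[y yP] : forall i, exists y, O y /\ x i = x l0 * y.
  by move=> i; have [y] := tx i; exists y.
exists (w^-1 * \sum_j (mev cst a p^`M(j) + r1 j) * y j).
  apply: (localM HO) => //; apply: (local_sum HO) => j _; apply: (localM HO).
    by apply: (localD HO) => //; case: (mr1 j).
  exact: (yP j).1.
rewrite ez e mulrC mulrCA; congr (_ * _); rewrite mulr_sumr.
by apply: eq_bigr => j _; rewrite (yP j).2; ring.
Qed.

End Uniformizer.

(** * Polynomial evaluation and uniformizers *)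

Lemma poly_split_X (R : nzRingType) (p : {poly R}) : exists r, p = (p`_0)%:P + r * 'X.
Proof.
exists (drop_poly 1 p); rewrite -{1}[p](poly_take_drop 1) expr1; congr (_ + _).
by apply/polyP => -[|i]; rewrite coef_take_poly coefC.
Qed.

Lemma poly_factor_X (R : idomainType) (p : {poly R}) : p != 0 ->
  exists e (r : {poly R}), r`_0 != 0 /\ p = r * 'X^e.
Proof.
move=> p0; have [e [r]] := multiplicity_XsubC p 0.
rewrite p0 /root horner_coef0 subr0 => r0 ->.
by exists e, r.
Qed.

Section Evaluation.
Variables (k K : fieldType) (cst : {rmorphism k -> K}).

Definition pev (u : K) : {rmorphism {poly k} -> K} :=
  horner_eval u \o map_poly cst.

(** Q(u, v), where the inner variable of Q goes to u and the outer one to v. *)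
Definition bev (u v : K) : {rmorphism {poly {poly k}} -> K} :=
  horner_eval v \o map_poly (pev u).

Lemma pevE u p : pev u p = (map_poly cst p).[u].
Proof. by []. Qed.
Lemma pevC u c : pev u c%:P = cst c.
Proof. by rewrite /= map_polyC horner_evalE hornerC. Qed.
Lemma pevX u : pev u 'X = u.
Proof. by rewrite /= map_polyX horner_evalE hornerX. Qed.
Lemma bevC u v p : bev u v p%:P = pev u p.
Proof. by rewrite /= map_polyC /= /horner_eval hornerC. Qed.
Lemma bevX u v : bev u v 'X = v.
Proof. by rewrite /= map_polyX horner_evalE hornerX. Qed.
Lemma bevE u v (Q : {poly {poly k}}) :
  bev u v Q = (map_poly (fun p => (map_poly cst p).[u]) Q).[v].
Proof. by []. Qed.

Global Opaque pev bev.

Lemma bev_swapXY u v Q : bev u v (swapXY Q) = bev v u Q.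
Proof.
elim/poly_ind: Q => [|Q p IHQ]; first by rewrite !rmorph0.
rewrite !(rmorphD, rmorphM) /= IHQ swapXY_X swapXY_polyC bevX bevC bevC pevX.
congr (_ + _); elim/poly_ind: p => [|p c IHp]; first by rewrite !rmorph0.
by rewrite !(rmorphD, rmorphM) /= IHp map_polyX map_polyC bevX bevC pevX !pevC.
Qed.

End Evaluation.

Section DVR.
Variables (k K : fieldType) (cst : {rmorphism k -> K}).
Local Notation pev := (pev cst).
Local Notation bev := (bev cst).
Section OnePoint.
Variable (O : set K).
Hypothesis HO : rational_local_ring cst O.
Local Notation m := (max_ideal O).

Lemma local_pev a p : O a -> O (pev a p).
Proof.
move=> Oa; elim/poly_ind: p => [|p c IHp]; first by rewrite rmorph0; apply: (local0 HO).
rewrite rmorphD rmorphM pevX pevC; apply: (localD HO); last exact: (local_cst HO).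
exact: (localM HO).
Qed.

Lemma local_bev a b p : O a -> O b -> O (bev a b p).
Proof.
move=> Oa Ob; elim/poly_ind: p => [|p c IHp]; first by rewrite rmorph0; apply: (local0 HO).
rewrite rmorphD rmorphM bevX bevC; apply: (localD HO); last exact: local_pev.
exact: (localM HO).
Qed.

Lemma pev_residue a p : m a -> exists2 y, O y & pev a p = cst p`_0 + a * y.
Proof.
move=> ma; have Oa : O a by case: ma.
have [r ->] := poly_split_X p; exists (pev a r); first exact: local_pev.
by rewrite rmorphD rmorphM pevX !pevC coefD coefC coefMX addr0 mulrC.
Qed.

(** Split off the power of the variable; what remains has a nonzero constant
coefficient, which is its residue at a. *)
Lemma pev_factor a p : m a -> p != 0 ->
  exists e y, [/\ O y, ~ m y & pev a p = a ^+ e * y].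
Proof.
move=> ma /poly_factor_X[e [r [r0 ->]]]; have Oa : O a by case: ma.
exists e, (pev a r); split; first exact: local_pev.
  have [y Oy ->] := pev_residue r ma => my; case/eqP: r0.
  apply: (max_ideal_cst HO); rewrite -(addrK (a * y) (cst _)).
  by apply: (max_idealB HO) => //; rewrite mulrC; apply: (max_idealM HO).
by rewrite rmorphM rmorphXn pevX mulrC.
Qed.

Lemma pev_neq0 a p : m a -> a != 0 -> p != 0 -> pev a p != 0.
Proof.
move=> ma a0 p0; have [e [y [Oy my ->]]] := pev_factor ma p0.
by rewrite mulf_neq0 ?expf_neq0 //; have [] := local_unit Oy my.
Qed.

(** Once divided by a power of the outer variable, the relation reads
p(a) = - b s(a, b) with p nonzero, and p(a) is a power of a up to a unit. *)
Lemma algebraic_divides_power a b (Q : {poly {poly k}}) :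
  Q != 0 -> bev a b Q = 0 -> m a -> O b -> b != 0 ->
  exists e y, O y /\ a ^+ e = b * y.
Proof.
move=> /poly_factor_X[e [r [r0 ->]]] + ma Ob b0.
rewrite rmorphM rmorphXn bevX => /eqP; rewrite mulf_eq0 expf_eq0 (negPf b0) andbF orbF.
have [s rE] := poly_split_X r; rewrite rE rmorphD rmorphM bevX bevC addr_eq0 => /eqP E.
have [f [y [Oy my py]]] := pev_factor ma r0; have [y0 Oy'] := local_unit Oy my.
exists f, (- bev a b s / y); split.
  apply: (localM HO) => //; apply: (localN HO); apply: local_bev => //; by case: ma.
by apply: (mulIf y0); rewrite -py E; field.
Qed.

Definition uniformizer t :=
  [/\ t != 0, m t & forall x, O x -> x != 0 ->
      exists j w, [/\ O w, ~ m w & x = t ^+ j * w]].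

(** What has to be bounded is the exponent of t in x. By
[algebraic_divides_power], the algebraic dependence of t and u puts a power of
t in u O, and that of u and x puts a power of u in x O; so some t^r is a
multiple of x, and x cannot be divisible by t^(r+1). *)
Lemma principal_uniformizer t u :
  (forall x, m x -> exists2 y, O y & x = t * y) -> m t ->
  m u -> u != 0 ->
  (forall y, exists2 Q : {poly {poly k}}, Q != 0 & bev u y Q = 0) ->
  uniformizer t.
Proof.
move=> tP mt mu u0 alg; have t0 : t != 0.
  by apply: contra_neq u0 => t0; have [y _ ->] := tP _ mu; rewrite t0 mul0r.
split=> // x Ox x0.
have [Q Q0 eQ] := alg t; have [Q' Q'0 eQ'] := alg x.
have Ou : O u by case: mu. have Ot : O t by case: mt.
have [|| e [y [Oy ey]]] := @algebraic_divides_power t u (swapXY Q) _ _ mt Ou u0.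
- by rewrite swapXY_eq0.
- by rewrite bev_swapXY.
have [e' [y' [Oy' ey']]] := algebraic_divides_power Q'0 eQ' mu Ox x0.
have [r [z [Oz ez]]] : exists r z, O z /\ t ^+ r = x * z.
  exists (e * e')%N, (y' * y ^+ e'); split.
    by apply: (localM HO) => //; apply: (localX HO).
  by rewrite exprM ey exprMn ey' mulrA.
pose S j := exists2 w, O w & x = t ^+ j * w.
have S0 : S 0%N by exists x => //; rewrite mul1r.
have nS : ~ S r.+1.
  case=> w Ow e1; apply: (@max_ideal_not1 _ O); rewrite (_ : 1 = (w * z) * t).
    by apply: (max_idealM HO) => //; apply: (localM HO).
  by apply: (mulfI (expf_neq0 r t0)); rewrite mulr1 {1}ez e1 exprS; ring.
have [j [Sj nSj]] : exists j, S j /\ ~ S j.+1.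
  apply: contrapT => nex; apply: nS; elim: r.+1 => // i Si.
  by apply: contrapT => nSi; apply: nex; exists i.
have [w Ow xE] := Sj; exists j, w; split=> // mw; apply: nSj.
by have [y1 Oy1 wE] := tP _ mw; exists y1 => //; rewrite xE wE exprSr mulrA.
Qed.

End OnePoint.
End DVR.

(** * Separation of the points of a fibre *)

Section Approximation.
Variables (k : finFieldType) (K : fieldType) (cst : {rmorphism k -> K}).
Local Notation pev := (pev cst).

Record rational_dvr (O : set K) : Prop := RationalDVR {
  dvr_local : rational_local_ring cst O;
  dvr_uniformizer : exists t, uniformizer O t;
  dvr_valuation : forall x, O x \/ max_ideal O x^-1 }.

Lemma uniformizer_dvr O t : rational_local_ring cst O -> uniformizer O t ->
  (forall x, exists a b, [/\ O a, O b, b != 0 & x = a / b]) -> rational_dvr O.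
Proof.
move=> HO [t0 mt tP] frac; split=> // [|x]; first by exists t.
have [a [b [Oa Ob b0 ->]]] := frac x.
have [->|a0] := eqVneq a 0; first by left; rewrite mul0r; apply: (local0 HO).
have [i [v [Ov /(local_unit Ov)[v0 Ov'] ->]]] := tP _ Oa a0.
have [j [w [Ow /(local_unit Ow)[w0 Ow'] ->]]] := tP _ Ob b0.
have Ot : O t by case: mt.
have [ji|ij] := leqP j i.
  left; rewrite (_ : _ / _ = t ^+ (i - j) * (v / w)).
    by apply: (localM HO); [apply: (localX HO) | apply: (localM HO)].
  by rewrite -{1}(subnK ji) exprD; field; rewrite w0 expf_neq0.
right; rewrite (_ : _^-1 = (t ^+ (j - i).-1 * (w / v)) * t).
  apply: (max_idealM HO) => //.
  by apply: (localM HO); [apply: (localX HO) | apply: (localM HO)].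
rewrite -{1}(subnK (ltnW ij)) exprD -(prednK (n := (j - i)%N)) ?subn_gt0 // exprS.
by field; rewrite v0 w0 !expf_neq0.
Qed.

(** Two generators of the maximal ideal differ by a unit. *)
Lemma unramified_uniformizer O u : rational_dvr O -> max_ideal O u ->
  (forall x, max_ideal O x -> exists2 y, O y & x = u * y) -> uniformizer O u.
Proof.
move=> HO mu uP; have LO := dvr_local HO; have [t [t0 mt tP]] := dvr_uniformizer HO.
have [s Os tE] := uP _ mt; have u0 : u != 0.
  by apply: contra_neq t0 => u0; rewrite tE u0 mul0r.
have [r Or uE] : exists2 r, O r & u = t * r.
  have [[|j] [w [Ow nw uE]]] := tP _ (max_ideal_sub mu) u0.
    by case: nw; rewrite -[w]mul1r -(expr0 t) -uE.
  exists (t ^+ j * w); last by rewrite uE exprS mulrA.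
  by apply: (localM LO) => //; apply: (localX LO); case: mt.
have rs : s * r = 1 by apply: (mulfI u0); rewrite mulrA -tE -uE mulr1.
split=> // x Ox x0; have [j [w [Ow nw xE]]] := tP _ Ox x0.
have [w0 Ow'] := local_unit Ow nw.
exists j, (s ^+ j * w); split.
- by apply: (localM LO) => //; apply: (localX LO).
- move=> msw; apply: nw; rewrite (_ : w = r ^+ j * (s ^+ j * w)).
    by apply: (max_idealM LO) => //; apply: (localX LO).
  by rewrite mulrA -exprMn [r * s]mulrC rs expr1n mul1r.
- by rewrite mulrA -exprMn -tE.
Qed.

(** Discrete valuation rings are maximal subrings.  The function u prevents W
from being the whole field: a uniformizer of V is not invertible in W, since a
power of it is u up to a unit.  An element of W with a pole at V would then be
the inverse of a nonunit of W. *)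
Lemma dvr_maximal V W u : rational_dvr V -> rational_dvr W ->
  max_ideal V u -> max_ideal W u -> u != 0 -> V `<=` W -> V = W.
Proof.
move=> HV HW Vu Wu u0 VW; apply/seteqP; split=> // x Wx.
have LV := dvr_local HV; have LW := dvr_local HW.
have [->|x0] := eqVneq x 0; first exact: (local0 LV).
have [//|mx'] := dvr_valuation HV x; exfalso.
have [t [t0 mt tP]] := dvr_uniformizer HV.
have VP y : max_ideal V y -> y != 0 ->
    exists i w, [/\ V w, V w^-1, w != 0 & y = t ^+ i.+1 * w].
  move=> my y0; have [[|i] [w [Vw nw yE]]] := tP _ (max_ideal_sub my) y0.
    by case: nw; rewrite -[w]mul1r -(expr0 t) -yE.
  by have [w0 Vw'] := local_unit Vw nw; exists i, w.
have Wt : W t by apply: VW; case: mt.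
have [i [w [Vw Vw' w0 uE]]] := VP _ Vu u0.
have mWt : max_ideal W t.
  apply: contrapT => /(local_unit Wt)[_ Wt']; move: Wu; apply: (max_ideal_inv LW) => //.
  rewrite uE invfM -exprVn; apply: (localM LW); last exact: VW.
  exact: (localX LW).
have x'0 : x^-1 != 0 by rewrite invr_eq0.
have [j [z [Vz _ _ xE]]] := VP _ mx' x'0.
apply: (@max_ideal_not1 _ W); rewrite -(mulfV x0) xE exprSr.
rewrite (_ : x * _ = (x * t ^+ j * z) * t); last by ring.
apply: (max_idealM LW) => //; apply: (localM LW); last exact: VW.
by apply: (localM LW) => //; apply: (localX LW).
Qed.

(** This polynomial takes the value 1 on all of k. *)
Let g x : K := x ^+ #|k| - x + 1.

Section Separators.
Variable V : set K.
Hypothesis HV : rational_dvr V.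
Let LV := dvr_local HV.

(** At a point where x is regular, g x has residue 1. *)
Lemma separator_in x : V x -> V (g x)^-1 /\ ~ max_ideal V (g x)^-1.
Proof.
move=> Vx.
have Vg : V (g x).
  apply: (localD LV); last exact: (local1 LV).
  by apply: (localB LV) => //; apply: (localX LV).
have [c mc] := local_residue LV Vx.
have ng : ~ max_ideal V (g x).
  apply: (local_unit_cong LV (@max_ideal_not1 _ V)).
  rewrite (_ : 1 - g x = (x - cst c) - (x ^+ #|k| - cst c)); last by rewrite /g; ring.
  apply: (max_idealB LV) => //.
  rewrite -[in cst c](expf_card c) rmorphXn subrXX mulrC.
  apply: (max_idealM LV) => //; apply: (local_sum LV) => i _.
  by apply: (localM LV); apply: (localX LV) => //; apply: (local_cst LV).
have [g0 Vg'] := local_unit Vg ng; split=> //.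
by apply: (max_ideal_inv LV); rewrite ?invrK ?invr_eq0.
Qed.

(** At a pole of x the term x^q dominates, and q > 1. *)
Lemma separator_out x : ~ V x -> max_ideal V (g x)^-1 /\ max_ideal V (x / g x).
Proof.
move=> Vx; have [//|] := dvr_valuation HV x.
have x0 : x != 0 by apply/eqP => x0; apply: Vx; rewrite x0; apply: (local0 LV).
set y := x^-1 => my; have Vy : V y by case: my.
have xE : x = y^-1 by rewrite invrK.
have y0 : y != 0 by rewrite invr_eq0.
have := finNzRing_gt1 k; case qE: #|k| => [//|[//|q]] _.
pose h := 1 - y ^+ q.+1 + y ^+ q.+2.
have gE : g x = h / y ^+ q.+2.
  by rewrite /g qE /h xE exprVn [y ^+ q.+2]exprS; field; rewrite y0 expf_neq0.
have Vh : V h.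
  apply: (localD LV); last exact: (localX LV).
  by apply: (localB LV); [apply: (local1 LV) | apply: (localX LV)].
have nh : ~ max_ideal V h.
  apply: (local_unit_cong LV (@max_ideal_not1 _ V)).
  rewrite (_ : 1 - h = (y ^+ q - y ^+ q.+1) * y); last by rewrite /h !exprS; ring.
  by apply: (max_idealM LV) => //; apply: (localB LV); apply: (localX LV).
have [h0 Vh'] := local_unit Vh nh.
have mxg : max_ideal V (x / g x).
  rewrite gE xE (_ : _ / _ = (y ^+ q * h^-1) * y).
    by apply: (max_idealM LV) => //; apply: (localM LV) => //; apply: (localX LV).
  by rewrite !exprS; field; rewrite y0 h0 expf_neq0.
by split=> //; rewrite -[_^-1](mulKf x0); apply: (max_idealM LV).
Qed.
End Separators.

Section Points.
Variables (N : nat) (O : 'I_N -> set K) (u : K).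
Hypothesis HO : forall i, rational_dvr (O i).
Hypothesis mu : forall i, max_ideal (O i) u.
Hypothesis u0 : u != 0.
Hypothesis O_inj : injective O.

(** For each j different from i choose x_j regular at i with a pole at j.  Then
1 / g x_j is regular at all the points, invertible at i and zero at j, so the
product over j will do. *)
Lemma point_separating_function i :
  exists z, [/\ O i z, ~ max_ideal (O i) z & forall j, j != i -> max_ideal (O j) z].
Proof.
have /choice[x xP] : forall j, exists x, O i x /\ (j != i -> ~ O j x).
  move=> j; have [->|ji] := eqVneq j i.
    by exists 0; split=> //; apply: (local0 (dvr_local (HO i))).
  apply: contrapT => nx; have: O i = O j.
    apply: (dvr_maximal (HO i) (HO j) (mu i) (mu j) u0) => x Ox.
    by apply: contrapT => nOx; apply: nx; exists x.
  by move/O_inj => ij; rewrite ij eqxx in ji.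
have Oi := dvr_local (HO i).
have sep j := separator_in (HO i) (xP j).1.
exists (\prod_(j | j != i) (g (x j))^-1).
have [Oz nz] : O i (\prod_(j | j != i) (g (x j))^-1) /\
    ~ max_ideal (O i) (\prod_(j | j != i) (g (x j))^-1).
  apply: (big_ind (fun z => O i z /\ ~ max_ideal (O i) z)) => //.
  - by split; [apply: (local1 Oi) | apply: max_ideal_not1].
  - move=> y z [Oy ny] [Oz nz]; split; first exact: (localM Oi).
    by case/(max_ideal_prime Oi Oy Oz).
split=> // j ji; have Oj := dvr_local (HO j).
have sepj l : O j (g (x l))^-1.
  have [Oxl|nOxl] := pselect (O j (x l)); first by have [] := separator_in (HO j) Oxl.
  by have [[]] := separator_out (HO j) nOxl.
rewrite (bigD1 j) //= mulrC; apply: (max_idealM Oj).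
  by apply: big_ind => //; [apply: (local1 Oj) | apply: (localM Oj)].
by have [] := separator_out (HO j) ((xP j).2 ji).
Qed.

(** If all the coefficients vanish at 0, divide the relation by u. *)
Lemma relation_nonzero_residue (I : finType) (e : I -> K) (c : I -> {poly k}) i :
  c i != 0 -> \sum_j pev u (c j) * e j = 0 ->
  exists2 c' : I -> {poly k}, exists i, (c' i)`_0 != 0 & \sum_j pev u (c' j) * e j = 0.
Proof.
move: {2}(size (c i)) (leqnn (size (c i))) => s; elim: s c => [|s IHs] c.
  by rewrite leqn0 size_poly_eq0 => /eqP ->; rewrite eqxx.
move=> cs ci0 e0; have [[l cl]|nc] := pselect (exists l, (c l)`_0 != 0).
  by exists c => //; exists l.
have /choice[c' c'E] : forall l, exists r, c l = r * 'X.
  move=> l; have [r rE] := poly_split_X (c l); exists r; rewrite {1}rE.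
  have -> : (c l)`_0 = 0 by apply/eqP/negPn/negP => cl; apply: nc; exists l.
  by rewrite add0r.
have c'i0 : c' i != 0 by apply: contra_neq ci0; rewrite c'E => ->; rewrite mul0r.
apply: (IHs c') => //; first by rewrite c'E size_mulX in cs.
apply: (mulfI u0); rewrite mulr0 mulr_sumr -[RHS]e0; apply: eq_bigr => l _.
by rewrite c'E rmorphM pevX; ring.
Qed.

(** Let z_i separate the points, let t be a uniformizer at i0, and put
w = z_i0 t / g t, which vanishes at all the points and is t up to a unit at i0.
Take a relation between w and the z_i over k[u] whose coefficients do not all
vanish at u = 0.  Its residue at the point i kills the constant coefficient of
z_i, so the constant coefficient of w is nonzero; solving for w at i0 then
shows that u divides t there. *)
Lemma full_fiber_unramified :
  (forall e : 'I_N.+1 -> K, exists c : 'I_N.+1 -> {poly k},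
     (exists i, c i != 0) /\ \sum_i pev u (c i) * e i = 0) ->
  forall i x, max_ideal (O i) x -> exists2 y, O i y & x = u * y.
Proof.
move=> dep i0; have Oi0 := dvr_local (HO i0).
have [t [t0 mt tP]] := dvr_uniformizer (HO i0).
have /choice[z zP] := point_separating_function.
pose w := z i0 * (t / g t).
have mw i : max_ideal (O i) w.
  have Oi := dvr_local (HO i).
  have mtg : O i (t / g t).
    have [Ot|nOt] := pselect (O i t); last by have [_ []] := separator_out (HO i) nOt.
    by apply: (localM Oi) => //; have [] := separator_in (HO i) Ot.
  have [->|ii0] := eqVneq i i0; last first.
    rewrite /w mulrC; apply: (max_idealM Oi) => //.
    by have [_ _] := zP i0; apply.
  have [Oz _ _] := zP i0; apply: (max_idealM Oi0) => //.
  rewrite mulrC; apply: (max_idealM Oi0) => //.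
  by have [] := separator_in (HO i0) (max_ideal_sub mt).
(* The family w, z_0, ..., z_(N-1) has one element more than the degree. *)
pose e i := oapp z w (unlift ord0 i).
have [c0 [[i1 ci1] e0]] := dep e.
have {c0 i1 ci1 e0} [c [i1 ci1]] := relation_nonzero_residue ci1 e0.
rewrite big_ord_recl {1}/e unlift_none /=.
have -> : \sum_(i < N) pev u (c (lift ord0 i)) * e (lift ord0 i) =
          \sum_(i < N) pev u (c (lift ord0 i)) * z i.
  by apply: eq_bigr => i _; rewrite /e liftK.
move/eqP; rewrite addr_eq0 => /eqP rel.
have Opev i p : O i (pev u p).
  by apply: (local_pev (dvr_local (HO i))); case: (mu i).
have cst0 i p : max_ideal (O i) (pev u p) -> p`_0 = 0.
  have Oi := dvr_local (HO i).
  have [y Oy ->] := pev_residue Oi p (mu i) => mp.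
  apply: (max_ideal_cst Oi); rewrite -(addrK (u * y) (cst _)).
  by apply: (max_idealB Oi) => //; rewrite mulrC; apply: (max_idealM Oi).
have c0 i : (c (lift ord0 i))`_0 = 0.
  have Oi := dvr_local (HO i); have [Ozi nzi zl] := zP i.
  apply: (cst0 i).
  have [//|/nzi //] : max_ideal (O i) (pev u (c (lift ord0 i))) \/ max_ideal (O i) (z i).
  apply: (max_ideal_prime Oi) => //.
  rewrite (_ : _ * _ = - (pev u (c ord0) * w) -
    \sum_(j < N | j != i) pev u (c (lift ord0 j)) * z j); last first.
    by rewrite rel opprK (bigD1 i) //= addrK.
  apply: (max_idealB Oi).
    by apply: (max_idealN Oi); apply: (max_idealM Oi).
  apply: (max_ideal_sum Oi) => j ji; apply: (max_idealM Oi) => //.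
  have [_ _] := zP j; apply; by rewrite eq_sym.
have c00 : (c ord0)`_0 != 0.
  by case: (unliftP ord0 i1) ci1 => [j ->|-> //]; rewrite c0 eqxx.
have [y Oy tE] : exists2 y, O i0 y & t = u * y.
  have Oz l : O i0 (z l).
    have [->|ll] := eqVneq l i0; first by case: (zP i0).
    by have [_ _ /(_ i0)] := zP l; rewrite eq_sym ll => /(_ isT)[].
  have /choice[y yP] : forall l, exists y, O i0 y /\ pev u (c (lift ord0 l)) = u * y.
    move=> l; have [y Oy ->] := pev_residue Oi0 (c (lift ord0 l)) (mu i0).
    by exists y; rewrite c0 rmorph0 add0r.
  have ncw : ~ max_ideal (O i0) (pev u (c ord0)) by move/cst0/eqP; rewrite (negPf c00).
  have [cw0 Ocw] := local_unit (Opev i0 _) ncw.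
  have [Ozi nzi _] := zP i0; have [z0 Oz'] := local_unit Ozi nzi.
  have Og : O i0 (g t).
    have Ot := max_ideal_sub mt.
    apply: (localD Oi0); last exact: (local1 Oi0).
    by apply: (localB Oi0) => //; apply: (localX Oi0).
  have [Og' ng'] := separator_in (HO i0) (max_ideal_sub mt).
  have [g0 _] := local_unit Og' ng'.
  exists (- (\sum_l y l * z l) * (pev u (c ord0))^-1 * (z i0)^-1 * g t).
    apply: (localM Oi0) => //; apply: (localM Oi0) => //; apply: (localM Oi0) => //.
    apply: (localN Oi0); apply: (local_sum Oi0) => l _.
    by apply: (localM Oi0) => //; case: (yP l).
  transitivity (pev u (c ord0) * w * (pev u (c ord0))^-1 * (z i0)^-1 * g t).
    by rewrite /w; field; rewrite cw0 z0 -invr_eq0.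
  rewrite rel !mulrA; congr (_ * _ * _ * _); rewrite mulrN mulr_sumr; congr (- _).
  by apply: eq_bigr => l _; rewrite (yP l).2 mulrA.
move=> x mx; have [->|x0] := eqVneq x 0.
  by exists 0; rewrite ?mulr0 //; apply: (local0 Oi0).
have [[|j] [v [Ov nv xE]]] := tP _ (max_ideal_sub mx) x0.
  by case: nv; rewrite -[v]mul1r -(expr0 t) -xE.
exists (y * t ^+ j * v); last by rewrite xE exprS {1}tE; ring.
apply: (localM Oi0) => //; apply: (localM Oi0) => //.
by apply: (localX Oi0); case: mt.
Qed.

End Points.
End Approximation.

(** * Laurent expansions *)

Lemma rmorphism_of_fun (R S : nzRingType) (f : R -> S) :
  zmod_morphism f -> monoid_morphism f -> exists g : {rmorphism R -> S}, g =1 f.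
Proof.
move=> fB fM.
pose mf := GRing.isZmodMorphism.Build R S f fB.
pose mm := GRing.isMonoidMorphism.Build R S f fM.
by exists (HB.pack_for {rmorphism R -> S} f mf mm).
Qed.

Section Expansion.
Variables (k : finFieldType) (K : fieldType) (cst : {rmorphism k -> K}).
Variables (O : set K) (u : K).
Hypothesis HO : rational_dvr cst O.
Hypothesis Uu : uniformizer O u.
Local Notation m := (max_ideal O).
Local Notation pev := (pev cst u).
Let LO := dvr_local HO.
Let u0 : u != 0. Proof. by case: Uu. Qed.
Let mu : m u. Proof. by case: Uu. Qed.
Let Ou : O u. Proof. by case: mu. Qed.

(** x is congruent to the truncations of f modulo every power of u.  The
truncations are only prescribed below degree n, so products of truncations can
be used as they are. *)
Definition expands x (f : powser k) := forall n, exists (p : {poly k}) y,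
  [/\ forall i, (i < n)%N -> p`_i = pscoef f i, O y & x = pev p + u ^+ n * y].

Lemma max_ideal_uniformizer x : m x -> exists2 y, O y & x = u * y.
Proof.
case: Uu => _ _ uP mx; have [->|x0] := eqVneq x 0.
  by exists 0; rewrite ?mulr0 //; apply: (local0 LO).
have [[|j] [w [Ow nw xE]]] := uP _ (max_ideal_sub mx) x0.
  by case: nw; rewrite -[w]mul1r -(expr0 u) -xE.
exists (u ^+ j * w); last by rewrite xE exprS mulrA.
by apply: (localM LO) => //; apply: (localX LO).
Qed.

Lemma expands_exists x : O x -> exists f, expands x f.
Proof.
have /choice[d dP] : forall x, exists d : k * K, O x -> O d.2 /\ x = cst d.1 + u * d.2.
  move=> y; have [Oy|nOy] := pselect (O y); last by exists (0, 0).
  have [c mc] := local_residue LO Oy; have [z Oz e] := max_ideal_uniformizer mc.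
  by exists (c, z) => _; split=> //=; rewrite -e addrC subrK.
move=> Ox; pose rest n := iter n (fun z => (d z).2) x.
have Orest n : O (rest n) by elim: n => // n IHn; have [] := dP _ IHn.
exists (PowSer (fun n => (d (rest n)).1)) => n.
exists (\poly_(i < n) (d (rest i)).1), (rest n); split=> //.
  by move=> i lt_in; rewrite coef_poly lt_in.
elim: n => [|n IHn].
  by rewrite poly_def big_ord0 rmorph0 add0r expr0 mul1r.
rewrite {1}IHn {1}(dP _ (Orest n)).2 !poly_def big_ord_recr /= rmorphD -mul_polyC.
by rewrite rmorphM rmorphXn pevX pevC exprS /=; ring.
Qed.

(** This is the uniqueness of expansions. *)
Lemma pev_valuation n p y : O y -> pev p = u ^+ n * y -> forall i, (i < n)%N -> p`_i = 0.
Proof.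
elim: n p => [|n IHn] p Oy //.
have [r ->] := poly_split_X p; rewrite rmorphD rmorphM pevX pevC => e.
have Or := local_pev LO r Ou.
have p0 : p`_0 = 0.
  apply: (max_ideal_cst LO); rewrite -(addrK (pev r * u) (cst _)) e exprS.
  rewrite (_ : _ - _ = (u ^+ n * y - pev r) * u); last by ring.
  apply: (max_idealM LO) => //; apply: (localB LO) => //.
  by apply: (localM LO) => //; apply: (localX LO).
rewrite p0 rmorph0 add0r in e.
have {e} /IHn rn : pev r = u ^+ n * y.
  by apply: (mulIf u0); rewrite e exprS; ring.
by case=> [|i] lt_in; rewrite coefD coefC coefMX /= ?p0 ?add0r // rn.
Qed.

Lemma expands_unique x f g : expands x f -> expands x g -> f = g.
Proof.
move=> xf xg; apply/powserP => n.
have [p [y [pf Oy xp]]] := xf n.+1; have [r [z [rg Oz xr]]] := xg n.+1.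
rewrite -pf // -rg //; apply/eqP; rewrite -subr_eq0 -coefB; apply/eqP.
apply: (@pev_valuation n.+1 _ (z - y)) => //; first exact: (localB LO).
by rewrite rmorphB mulrBr; apply/eqP; rewrite subr_eq addrAC eq_sym subr_eq -xp addrC -xr.
Qed.

Lemma expandsB x y f g : expands x f -> expands y g -> expands (x - y) (f - g).
Proof.
move=> xf yg n; have [p [a [pf Oa ->]]] := xf n; have [r [b [rg Ob ->]]] := yg n.
exists (p - r), (a - b); split; first by move=> i lt_in; rewrite coefB pf // rg.
  exact: (localB LO).
by rewrite rmorphB; ring.
Qed.

Lemma expandsM x y f g : expands x f -> expands y g -> expands (x * y) (f * g).
Proof.
move=> xf yg n; have [p [a [pf Oa ->]]] := xf n; have [r [b [rg Ob ->]]] := yg n.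
exists (p * r), (pev p * b + pev r * a + u ^+ n * (a * b)); split.
- move=> i lt_in; rewrite coefM; apply: eq_bigr => j _.
  rewrite pf ?rg // ?(leq_ltn_trans (leq_subr _ _)) //.
  by rewrite (leq_ltn_trans _ lt_in) // -ltnS.
- apply: (localD LO).
    by apply: (localD LO); apply: (localM LO) => //; apply: (local_pev LO).
  by apply: (localM LO); [apply: (localX LO) | apply: (localM LO)].
- by rewrite rmorphM; ring.
Qed.

Lemma expands_pev p : expands (pev p) (powser_of_poly p).
Proof.
move=> n; exists p, 0; split=> //; first exact: (local0 LO).
by rewrite mulr0 addr0.
Qed.

(** x is a power of u times a unit, and the expansion of a unit is invertible,
so the expansion of x divides that of a power of u. *)
Lemma expands_neq0 x f : expands x f -> O x -> x != 0 -> f != 0.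
Proof.
move=> xf Ox x0; have [_ _ uP] := Uu; have [j [w [Ow nw xE]]] := uP _ Ox x0.
have [w0 Ow'] := local_unit Ow nw.
have [g xg] := expands_exists Ow'.
have := expandsM xf xg; rewrite {1}xE mulfK //.
have -> : u ^+ j = pev 'X^j by rewrite rmorphXn pevX.
move=> e; have := expands_unique e (expands_pev _).
apply: contra_eq_neq => ->; rewrite mul0r eq_sym -(rmorph0 (@powser_of_poly k)).
by rewrite (inj_eq (@powser_of_poly_inj k)) expf_neq0 // polyX_eq0.
Qed.

(** The expansion of an element of O is a power series by [expands_exists] and
[expands_unique]; quotients extend it to the whole field.  It recovers O: the
inverse of an element outside O is a multiple of u, and u is not invertible in
k[[u]]. *)
Theorem Laurent_expansion : exists sigma : {rmorphism K -> laurent k},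
  (forall p, sigma (pev p) = tofrac (powser_of_poly p)) /\
  (forall x, O x <-> exists f, sigma x = tofrac f).
Proof.
have /choice[tau tauP] : forall x, exists f, O x -> expands x f.
  by move=> x; have [/expands_exists[f xf]|nOx] := pselect (O x); [exists f | exists 0].
have tauE x f : O x -> expands x f -> tau x = f.
  by move=> /tauP; apply: expands_unique.
have O1 := local1 LO.
have tauM x y : O x -> O y -> tau (x * y) = tau x * tau y.
  by move=> Ox Oy; apply: tauE; [apply: (localM LO) | apply: expandsM; apply: tauP].
have tauB x y : O x -> O y -> tau (x - y) = tau x - tau y.
  by move=> Ox Oy; apply: tauE; [apply: (localB LO) | apply: expandsB; apply: tauP].
have tau_pev p : tau (pev p) = powser_of_poly p.
  by apply: tauE; [apply: (local_pev LO) | apply: expands_pev].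
have tau1 : tau 1 = 1 by rewrite -(rmorph1 pev) tau_pev rmorph1.
have tau0 x : O x -> x != 0 -> tofrac (tau x) != 0.
  by move=> Ox; rewrite tofrac_eq0; apply: expands_neq0 => //; apply: tauP.
(* A valuation ring contains each element or its inverse. *)
have /choice[fr frP] : forall z, exists ab : K * K,
    [/\ O ab.1, O ab.2, ab.2 != 0 & z = ab.1 / ab.2].
  move=> z; have [Oz|[Oz _]] := dvr_valuation HO z.
    by exists (z, 1); split=> //=; rewrite ?oner_eq0 ?divr1.
  have [->|z0] := eqVneq z 0.
    by exists (0, 1); split=> //=; rewrite ?oner_eq0 ?divr1 //; apply: (local0 LO).
  by exists (1, z^-1); split=> //=; rewrite ?invr_eq0 // invrK mul1r.
pose s z : laurent k := tofrac (tau (fr z).1) / tofrac (tau (fr z).2).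
have sE a b : O a -> O b -> b != 0 -> s (a / b) = tofrac (tau a) / tofrac (tau b).
  move=> Oa Ob b0; rewrite /s; have [Oc Od d0 e] := frP (a / b).
  apply/eqP; rewrite eqr_div ?tau0 // -!rmorphM -!tauM //; apply/eqP.
  congr (tofrac (tau _)); apply/eqP; rewrite -eqr_div //; exact/eqP.
have sO x : O x -> s x = tofrac (tau x).
  by move=> Ox; rewrite -[x]divr1 sE ?oner_neq0 // tau1 divr1 divr1.
have sB : zmod_morphism s.
  move=> x y; have [Oa Ob b0 xE] := frP x; have [Oc Od d0 yE] := frP y.
  rewrite [in LHS]xE [in LHS]yE.
  have -> : (fr x).1 / (fr x).2 - (fr y).1 / (fr y).2 =
     ((fr x).1 * (fr y).2 - (fr y).1 * (fr x).2) / ((fr x).2 * (fr y).2).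
    by field; rewrite b0 d0.
  have OM := localM LO.
  rewrite sE ?mulf_neq0 //; [|by apply: (localB LO); apply: OM|exact: OM].
  rewrite tauB ?tauM //; [|exact: OM|exact: OM].
  by rewrite rmorphB !rmorphM /s -[in RHS]mulNr addf_div ?tau0 // mulNr.
have sM : monoid_morphism s.
  split=> [|x y]; first by rewrite sO // tau1 rmorph1.
  have [Oa Ob b0 xE] := frP x; have [Oc Od d0 yE] := frP y.
  rewrite [in LHS]xE [in LHS]yE mulf_div; have OM := localM LO.
  rewrite sE ?mulf_neq0 //; [|exact: OM|exact: OM].
  by rewrite !tauM // !rmorphM -mulf_div.
have [sigma sigmaE] := rmorphism_of_fun sB sM; exists sigma; split=> [p|x].
  by rewrite sigmaE sO ?tau_pev //; apply: (local_pev LO).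
split=> [Ox|[f]]; first by exists (tau x); rewrite sigmaE sO.
move=> xf; have [//|mx'] := dvr_valuation HO x.
have [->|x0] := eqVneq x 0; first exact: (local0 LO).
have [y Oy xE] := max_ideal_uniformizer mx'; exfalso.
have := mulfV x0; rewrite xE => /(congr1 sigma)/eqP.
rewrite rmorph1 !rmorphM xf [sigma u]sigmaE [sigma y]sigmaE !sO //.
have -> : tau u = powser_of_poly 'X by rewrite -tau_pev pevX.
rewrite -!rmorphM -(rmorph1 (@tofrac (powser k))) tofrac_eq.
move/eqP/(congr1 (@pscoef k ^~ 0%N))/eqP.
by rewrite /= big_ord1 /= big_ord1 coefX mul0r mulr0 eq_sym oner_eq0.
Qed.

End Expansion.

(** * Degrees and polynomial relations *)

Section FractionField.
Variables (R : idomainType).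

Lemma fraction_inj : injective (@tofrac R).
Proof. by move=> x y /eqP; rewrite tofrac_eq => /eqP. Qed.

Lemma common_denominator (I : finType) (c : I -> {fraction R}) :
  exists2 D, D != 0 & exists c', forall i, c i * tofrac D = tofrac (c' i).
Proof.
pose n i := \n_(repr (c i)); pose d i := \d_(repr (c i)).
have d0 i : d i != 0 by apply: denom_ratioP.
exists (\prod_i d i); first by apply/prodf_neq0.
exists (fun i => n i * \prod_(j | j != i) d j) => i.
rewrite (bigD1 i) //= !rmorphM {1}[c i]frac_repr -/(n i) -/(d i) mulrA mulfVK //.
by rewrite tofrac_eq0.
Qed.

(** Bundles [frac_ext] as a ring morphism. *)
Lemma fraction_extension (L : fieldType) (phi : {rmorphism R -> L}) :
  injective phi -> exists iota : {rmorphism {fraction R} -> L},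
    iota =1 frac_ext phi /\ forall x, iota (tofrac x) = phi x.
Proof.
move=> phi_inj; have phi0 x : x != 0 -> phi x != 0.
  by rewrite -(rmorph0 phi) (inj_eq phi_inj).
have tofrac0 (x : R) : x != 0 -> tofrac x != 0 by rewrite tofrac_eq0.
have fE x : frac_ext phi (tofrac x) = phi x.
  by rewrite -[tofrac x]divr1 -(rmorph1 (@tofrac R)) frac_extE ?oner_neq0 // rmorph1 divr1.
have repr2 (x : {fraction R}) : exists a b, b != 0 /\ x = tofrac a / tofrac b.
  by exists \n_(repr x), \d_(repr x); rewrite -frac_repr; split=> //; apply: denom_ratioP.
have fB : zmod_morphism (frac_ext phi).
  move=> x y; have [a [b [b0 ->]]] := repr2 x; have [c [d [d0 ->]]] := repr2 y.
  rewrite -mulNr addf_div ?tofrac0 // mulNr -!rmorphM -rmorphB.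
  rewrite !frac_extE ?mulf_neq0 // rmorphB !rmorphM.
  by field; rewrite !phi0.
have fM : monoid_morphism (frac_ext phi).
  split=> [|x y]; first by rewrite -(rmorph1 (@tofrac R)) fE rmorph1.
  have [a [b [b0 ->]]] := repr2 x; have [c [d [d0 ->]]] := repr2 y.
  by rewrite mulf_div -!rmorphM !frac_extE ?mulf_neq0 // !rmorphM mulf_div.
have [iota iotaE] := rmorphism_of_fun fB fM.
by exists iota; split=> // x; rewrite iotaE.
Qed.

End FractionField.

Section Dimension.
Variables (L K : fieldType) (iota : {rmorphism L -> K}).

(** The coordinates form an m x d matrix with m > d, whose left kernel is not
zero. *)
Lemma span_dependence d m (w : 'I_d -> K) (e : 'I_m -> K) :
  (forall j, exists c : 'I_d -> L, e j = \sum_i iota (c i) * w i) -> (d < m)%N ->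
  exists c : 'I_m -> L, (exists i, c i != 0) /\ \sum_j iota (c j) * e j = 0.
Proof.
move=> /choice[M eM] dm; pose A := \matrix_(j, i) M j i.
have /rowV0Pn[r /sub_kermxP rA r0] : kermx A != 0.
  rewrite kermx_eq0 /row_free; apply: contraL dm => /eqP <-.
  by rewrite -leqNgt rank_leq_col.
have [i ri] : exists i, r ord0 i != 0.
  apply: contrapT => nr; case/eqP: r0; apply/rowP => i; rewrite mxE.
  by apply/eqP/negPn/negP => ri; apply: nr; exists i.
exists (r ord0); split; first by exists i.
under eq_bigr => j _ do rewrite eM mulr_sumr.
rewrite exchange_big big1 //= => l _; have /rowP/(_ l) := rA.
rewrite !mxE => /(congr1 iota); rewrite rmorph0 rmorph_sum => rl.
transitivity (\sum_j iota (r 0 j * A j l) * w l); last by rewrite -mulr_suml rl mul0r.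
by apply: eq_bigr => j _; rewrite rmorphM mxE mulrA.
Qed.

Variables (E : set K) (N : nat).
Hypothesis EP : forall z, E z <-> exists c, z = iota c.
Hypothesis degE : ext_degree E setT N.

Lemma ext_degree_dependence m (e : 'I_m -> K) : (N < m)%N ->
  exists c : 'I_m -> L, (exists i, c i != 0) /\ \sum_j iota (c j) * e j = 0.
Proof.
case: degE => b _ bP; apply: (span_dependence (w := b)) => j.
have [c [[Ec ec] _]] := bP (e j) I.
have /choice[c' c'E] : forall i, exists x, c i = iota x by move=> i; apply/EP.
by exists c'; rewrite ec; apply: eq_bigr => i _; rewrite c'E.
Qed.

Lemma ext_degree_span d (w : 'I_d -> K) :
  (forall x, exists c : 'I_d -> L, x = \sum_i iota (c i) * w i) -> (N <= d)%N.
Proof.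
case: degE => b _ bP spanw; rewrite leqNgt; apply/negP => dN.
have [c [[i ci] c0]] := span_dependence (fun j => spanw (b j)) dN.
have [c1 [_ uniq_c]] := bP 0 I.
have e0 : c1 = [ffun=> 0].
  apply: uniq_c; split=> [j|]; first by rewrite ffunE; apply/EP; exists 0; rewrite rmorph0.
  by rewrite big1 // => j _; rewrite ffunE mul0r.
have e1 : c1 = [ffun j => iota (c j)].
  apply: uniq_c; split=> [j|]; first by rewrite ffunE; apply/EP; exists (c j).
  by rewrite -[LHS]c0; apply: eq_bigr => j _; rewrite ffunE.
move: e1; rewrite e0 => /ffunP/(_ i); rewrite !ffunE => /esym/eqP.
by rewrite fmorph_eq0 (negPf ci).
Qed.

End Dimension.

Section Relations.
Variables (k K : fieldType) (cst : {rmorphism k -> K}).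
Local Notation pev := (pev cst).
Local Notation bev := (bev cst).

(** An induction principle for the elements of a finitely generated algebra. *)
Lemma mev_ind m (a : m.-tuple K) (S : set K) :
  (forall c, S (cst c)) -> (forall i, S (tnth a i)) ->
  (forall x y, S x -> S y -> S (x + y)) ->
  (forall x y, S x -> S y -> S (x * y)) -> forall p, S (mev cst a p).
Proof.
move=> SC Sa SD SM; apply: mpoly_ring_ind => [c|i|p r Sp Sr|p r Sp Sr].
- by rewrite mevC.
- by rewrite mevX.
- by rewrite mevD; apply: SD.
- by rewrite mevM; apply: SM.
Qed.

Lemma gen_field1P u z : gen_field cst [tuple u] z <->
  exists p s, pev u s != 0 /\ z = pev u p / pev u s.
Proof.
have to_poly p : exists r, mev cst [tuple u] p = pev u r.
  apply: (mev_ind (S := [set z | exists r, z = pev u r])) p.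
  - by move=> c; exists c%:P; rewrite pevC.
  - by move=> i; exists 'X; rewrite pevX ord1.
  - by move=> _ _ [p ->] [r ->]; exists (p + r); rewrite rmorphD.
  - by move=> _ _ [p ->] [r ->]; exists (p * r); rewrite rmorphM.
have to_mpoly r : exists p, mev cst [tuple u] p = pev u r.
  elim/poly_ind: r => [|r c [p ep]].
    by exists 0%:MP; rewrite mevC !rmorph0.
  by exists (p * 'X_ord0 + c%:MP); rewrite mevD mevM mevX mevC ep rmorphD rmorphM pevX pevC.
split=> [[p [s [s0 ->]]]|[p [s [s0 ->]]]].
  have [p' ep] := to_poly p; have [s' es] := to_poly s.
  by exists p', s'; rewrite -ep -es.
have [p' ep] := to_mpoly p; have [s' es] := to_mpoly s.
by exists p', s'; rewrite ep es.
Qed.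

Lemma gen_field2_fraction u v z : gen_field cst [tuple u; v] z ->
  exists p s, bev u v s != 0 /\ z = bev u v p / bev u v s.
Proof.
have to_poly p : exists r, mev cst [tuple u; v] p = bev u v r.
  apply: (mev_ind (S := [set z | exists r, z = bev u v r])) p.
  - by move=> c; exists c%:P%:P; rewrite bevC pevC.
  - case=> -[|[|//]] i; rewrite (tnth_nth 0) /=.
      by exists 'X%:P; rewrite bevC pevX.
    by exists 'X; rewrite bevX.
  - by move=> _ _ [p ->] [r ->]; exists (p + r); rewrite rmorphD.
  - by move=> _ _ [p ->] [r ->]; exists (p * r); rewrite rmorphM.
case=> p [s [s0 ->]]; have [p' ep] := to_poly p; have [s' es] := to_poly s.
by exists p', s'; rewrite -ep -es.
Qed.

Lemma bev_sum u v n (Q : {poly {poly k}}) : (size Q <= n)%N ->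
  bev u v Q = \sum_(i < n) pev u Q`_i * v ^+ i.
Proof.
move=> sQ; have -> : Q = \poly_(i < n) Q`_i.
  apply/polyP => i; rewrite coef_poly; case: ltnP => // ni.
  by rewrite nth_default // (leq_trans sQ).
rewrite poly_def rmorph_sum; apply: eq_bigr => i _.
by rewrite -mul_polyC rmorphM rmorphXn bevC bevX -poly_def coef_poly ltn_ord.
Qed.

Section Transcendental.
Variables (u : K) (N : nat).
Hypothesis u_tr : forall p, p != 0 -> pev u p != 0.
Hypothesis degu : ext_degree (gen_field cst [tuple u]) setT N.

Lemma transcendental_inj : injective (pev u).
Proof.
move=> p r e; apply/eqP; rewrite -subr_eq0; apply/negPn/negP => /u_tr.
by rewrite rmorphB e subrr eqxx.
Qed.

Lemma ratfun_embedding : exists iota : {rmorphism ratfun k -> K},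
  [/\ iota =1 frac_ext (pev u), forall p, iota (tofrac p) = pev u p &
      forall z, gen_field cst [tuple u] z <-> exists c, z = iota c].
Proof.
have [iota [iotaE iotaP]] := fraction_extension transcendental_inj.
exists iota; split=> // z; rewrite gen_field1P; split=> [[p [s [s0 ->]]]|[c ->]].
  by exists (tofrac p / tofrac s); rewrite fmorph_div !iotaP.
exists \n_(repr c), \d_(repr c); split; first exact/u_tr/denom_ratioP.
by rewrite {1}[c]frac_repr fmorph_div !iotaP.
Qed.

Lemma polynomial_dependence m (e : 'I_m -> K) : (N < m)%N ->
  exists c : 'I_m -> {poly k}, (exists i, c i != 0) /\ \sum_j pev u (c j) * e j = 0.
Proof.
have [iota [_ iotaP EP]] := ratfun_embedding => Nm.
have [c [[i ci] c0]] := ext_degree_dependence EP degu e Nm.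
have [D D0 [c' cD]] := common_denominator c.
have fD0 : tofrac D != 0 by rewrite tofrac_eq0.
exists c'; split.
  exists i; apply: contra_neq ci => c'i.
  by apply: (mulIf fD0); rewrite cD c'i rmorph0 mul0r.
transitivity (pev u D * \sum_j iota (c j) * e j); last by rewrite c0 mulr0.
rewrite mulr_sumr; apply: eq_bigr => j _.
by rewrite -iotaP -cD rmorphM iotaP; ring.
Qed.

(** The powers 1, v, ..., v^N are dependent over k(u). *)
Lemma small_relation v :
  exists Q : {poly {poly k}}, [/\ Q != 0, bev u v Q = 0 & (size Q <= N.+1)%N].
Proof.
have [c [[i ci] c0]] := polynomial_dependence (fun i : 'I_N.+1 => v ^+ i) (ltnSn N).
have cE j : (\poly_(l < N.+1) c (inord l))`_j = if (j < N.+1)%N then c (inord j) else 0.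
  exact: coef_poly.
exists (\poly_(l < N.+1) c (inord l)); split.
- apply: contra_neq ci => /polyP/(_ i); rewrite cE ltn_ord inord_val coef0 //.
- rewrite (bev_sum _ _ (size_poly _ _)) -[RHS]c0; apply: eq_bigr => j _.
  by rewrite cE ltn_ord inord_val.
- exact: size_poly.
Qed.

Variable v : K.
Hypothesis gen : forall z, exists p s, bev u v s != 0 /\ z = bev u v p / bev u v s.

(** Let F be a relation for v of least size over k(u).  The subring k(u)[v] is
a field: a polynomial not vanishing at v is coprime to F by minimality of F,
and Bezout's identity provides the inverse.  So it is k(u,v), which is the
whole field, and the powers of v below the degree of F span it. *)
Lemma relation_size (Q : {poly {poly k}}) : Q != 0 -> bev u v Q = 0 -> (N < size Q)%N.
Proof.
have [iota [_ iotaP EP]] := ratfun_embedding.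
pose ev : {rmorphism {poly ratfun k} -> K} := horner_eval v \o map_poly iota.
have evE F : ev F = (map_poly iota F).[v] by [].
have ev_tofrac P : ev (map_poly (@tofrac _) P) = bev u v P.
  rewrite (bev_sum _ _ (leqnn _)) evE -map_poly_comp (eq_map_poly iotaP) /=.
  rewrite horner_coef size_map_inj_poly ?rmorph0 //; last exact: transcendental_inj.
  by apply: eq_bigr => i _; rewrite coef_map.
move: ev evE ev_tofrac => ev evE ev_tofrac.
have tofrac_inj : injective (map_poly (@tofrac {poly k})).
  by apply: map_inj_poly; [apply: fraction_inj | apply: rmorph0].
pose rel n := `[< exists F, [/\ F != 0, ev F = 0 & size F = n] >].
move=> Q0 eQ; have relQ : rel (size Q).
  apply/asboolP; exists (map_poly (@tofrac _) Q); rewrite ev_tofrac; split=> //.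
    by rewrite -(rmorph0 (map_poly (@tofrac _))) (inj_eq tofrac_inj).
  by rewrite size_map_inj_poly ?rmorph0 //; apply: fraction_inj.
have [n /asboolP[F [F0 eF <-]] n_min] := ex_minnP (ex_intro rel _ relQ).
apply: leq_trans (n_min _ relQ).
have minF G : G != 0 -> ev G = 0 -> (size F <= size G)%N.
  by move=> G0 eG; apply: n_min; apply/asboolP; exists G.
have sF : (0 < size F)%N by rewrite size_poly_gt0.
rewrite -(prednK sF) ltnS; apply: (ext_degree_span EP degu (w := fun i => v ^+ i)) => z.
have [P [S [S0 ->]]] := gen z.
pose f := map_poly (@tofrac {poly k}).
have coFS : coprimep F (f S).
  rewrite /coprimep; set g := gcdp F (f S).
  have /dvdpP[e eE] : g %| F by apply: dvdp_gcdl.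
  have /dvdpP[h hE] : g %| f S by apply: dvdp_gcdr.
  have evg : ev g != 0.
    by apply: contra_neq S0 => eg; rewrite -ev_tofrac -/f hE rmorphM eg mulr0.
  have /eqP : ev e * ev g = 0 by rewrite -rmorphM -eE.
  rewrite mulf_eq0 (negPf evg) orbF => /eqP ee.
  have e0 : e != 0 by apply: contra_neq F0 => e0; rewrite eE e0 mul0r.
  have g0 : g != 0 by apply: contra_neq F0 => g0; rewrite eE g0 mulr0.
  have := minF e e0 ee; rewrite eE size_mul // -subn1 leq_subLR addnC leq_add2r => sg.
  by rewrite eqn_leq sg size_poly_gt0.
have [[a b] /= ab1] := Bezout_eq1_coprimepP _ _ coFS.
(* Evaluating a F + b S = 1 at v. *)
have evb : ev b = (bev u v S)^-1.
  apply: (mulIf S0); rewrite mulVf // -ev_tofrac -rmorphM -[RHS](rmorph1 ev) -ab1.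
  by rewrite rmorphD !rmorphM eF mulr0 add0r.
pose r := (f P * b) %% F.
have sr : (size r <= (size F).-1)%N by rewrite -ltnS prednK // ltn_modp.
exists (fun i => r`_i).
have <- : ev r = bev u v P / bev u v S.
  rewrite -evb -ev_tofrac -rmorphM -/f {1}(divp_eq (f P * b) F) rmorphD rmorphM eF.
  by rewrite mulr0 add0r.
rewrite evE (horner_coef_wide _ (n := (size F).-1)) ?size_map_poly //.
by apply: eq_bigr => i _; rewrite coef_map.
Qed.

End Transcendental.
End Relations.

(** * Gauss's lemma over k[u] *)

Section Gauss.
Variable k : fieldType.
Implicit Types (p h d : {poly k}) (f g w : {poly {poly k}}).

(** A divisor of least degree among the nonconstant ones. *)
Lemma irreducible_divisor h : (1 < size h)%N ->
  exists2 p, irreducible_poly p & p %| h.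
Proof.
move=> sh; have h0 : h != 0 by rewrite -size_poly_gt0 ltnW.
pose D n := `[< exists d, [/\ d %| h, (1 < size d)%N & size d = n] >].
have Dh : D (size h) by apply/asboolP; exists h; rewrite dvdpp.
have [n /asboolP[p [ph sp <-]] n_min] := ex_minnP (ex_intro D _ Dh).
exists p => //; split=> // d sd dp; rewrite -dvdp_size_eqp //.
have d0 : d != 0.
  by apply: contraTneq sp => d0; move: dp; rewrite d0 dvd0p => /eqP ->; rewrite size_poly0.
have sd1 : (1 < size d)%N by rewrite ltn_neqAle eq_sym sd size_poly_gt0.
rewrite eqn_leq (dvdp_leq _ dp) ?n_min //; last by rewrite -size_poly_gt0 ltnW.
by apply/asboolP; exists d; split=> //; apply: dvdp_trans ph.
Qed.

Lemma irreducible_prime p a b : irreducible_poly p -> p %| a * b -> (p %| a) || (p %| b).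
Proof.
move=> [sp irr] pab; have [//|npa] := boolP (p %| a).
have cop : coprimep p a.
  rewrite /coprimep; apply: contraNT npa => sg.
  by rewrite -(eqp_dvdl _ (irr _ sg (dvdp_gcdl p a))) dvdp_gcdr.
by rewrite -(Gauss_dvdpr _ cop).
Qed.

(** If p divides neither f nor w, look at the coefficient of f w whose index is
the sum of the first indices at which p fails to divide f and w. *)
Lemma Gauss_content p f w : irreducible_poly p -> (forall i, p %| (f * w)`_i) ->
  (forall i, p %| f`_i) \/ (forall i, p %| w`_i).
Proof.
move=> irr pfw; apply: contrapT => /not_orP[/existsNP[i0 nf] /existsNP[j0 nw]].
have [i fi i_min] := ex_minnP (ex_intro (fun i => ~~ (p %| f`_i)) _ (introN idP nf)).
have [j wj j_min] := ex_minnP (ex_intro (fun i => ~~ (p %| w`_i)) _ (introN idP nw)).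
have lt_i l : (l < i)%N -> p %| f`_l by apply: contraTT => /i_min; rewrite -leqNgt.
have lt_j l : (l < j)%N -> p %| w`_l by apply: contraTT => /j_min; rewrite -leqNgt.
have iS : (i < (i + j).+1)%N by rewrite ltnS leq_addr.
have := pfw (i + j)%N; rewrite coefM (bigD1 (Ordinal iS)) //= addKn dvdp_addl.
  by case/(irreducible_prime irr)/orP; apply/negP.
apply: (big_ind (fun a => p %| a)) => [|a b|l]; [exact: dvdp0 | exact: dvdp_add |].
rewrite -val_eqE /= neq_ltn => /orP[li|il]; first by rewrite dvdp_mulr ?lt_i.
rewrite dvdp_mull // lt_j // ltn_subLR ?ltn_add2r //.
by rewrite -ltnS.
Qed.

(** Cancel the irreducible factors of h one at a time: each of them divides the
content of f w, hence that of w since f is primitive. *)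
Lemma primitive_divides f g h w :
  (forall d, (forall i, d %| f`_i) -> size d = 1%N) -> h != 0 ->
  h%:P * g = f * w -> exists w', g = f * w'.
Proof.
move=> prim; move: {2}(size h) (leqnn (size h)) => s; elim: s h w => [|s IHs] h w.
  by rewrite leqn0 size_poly_eq0 => ->.
move=> sh h0 e; have [sh1|] := leqP (size h) 1.
  have := size1_polyC sh1; set c := h`_0 => hE.
  have c0 : c != 0 by apply: contra_neq h0 => c0; rewrite hE c0.
  exists (c^-1%:P%:P * w); rewrite mulrCA -e hE mulrA -!rmorphM mulVf //.
  by rewrite !rmorph1 mul1r.
case/irreducible_divisor=> p irr /dvdpP[h1 hE].
have p0 := irredp_neq0 irr.
have [pf|pw] : (forall i, p %| f`_i) \/ (forall i, p %| w`_i).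
- by apply: Gauss_content => // i; rewrite -e coefCM dvdp_mulr // hE dvdp_mulIr.
- by case: irr => + _; rewrite prim.
have wE : w = p%:P * \poly_(i < size w) (w`_i %/ p).
  apply/polyP => i; rewrite coefCM coef_poly; case: ltnP => [_|wi].
    by rewrite mulrC divpK.
  by rewrite nth_default // mulr0.
have h10 : h1 != 0 by apply: contra_neq h0 => h10; rewrite hE h10 mul0r.
apply: (IHs h1 (\poly_(i < size w) (w`_i %/ p))) => //.
  rewrite -ltnS (leq_trans _ sh) // hE size_mul // -[ltnLHS]addn0 -subn1 -addnBA.
    by rewrite ltn_add2l subn_gt0; case: irr.
  by rewrite size_poly_gt0.
have pP0 : p%:P != 0 :> {poly {poly k}} by rewrite polyC_eq0.
apply: (mulfI pP0); rewrite mulrA -rmorphM mulrC in e *.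
by rewrite [p * h1]mulrC -hE mulrC e {1}wE mulrCA.
Qed.

End Gauss.

(** * The height *)

Section Height.
Variables (k : fieldType) (X : curve k) (u v : κ(X)) (n N : nat).
Local Notation pev := (pev (cst X)).
Local Notation bev := (bev (cst X)).
Hypothesis N0 : (0 < N)%N.
Hypothesis u_tr : forall p, p != 0 -> pev u p != 0.
Hypothesis v_tr : forall p, p != 0 -> pev v p != 0.
Hypothesis degu : ext_degree (gen_field (cst X) [tuple u]) setT N.
Hypothesis degv : ext_degree (gen_field (cst X) [tuple v]) setT n.
Hypothesis gen : gen_field (cst X) [tuple u; v] = setT.

Let gen_uv z : exists p s, bev u v s != 0 /\ z = bev u v p / bev u v s.
Proof. by apply: gen_field2_fraction; rewrite gen. Qed.

Let gen_vu z : exists p s, bev v u s != 0 /\ z = bev v u p / bev v u s.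
Proof.
by have [p [s]] := gen_uv z; exists (swapXY p), (swapXY s); rewrite !bev_swapXY.
Qed.

Local Notation fr := (map_poly (@tofrac {poly k})).

Lemma size_tofrac (Q : {poly {poly k}}) : size (fr Q) = size Q.
Proof. by rewrite size_map_inj_poly ?rmorph0 //; apply: fraction_inj. Qed.

Lemma tofrac_poly_eq0 (Q : {poly {poly k}}) : (fr Q == 0) = (Q == 0).
Proof. by rewrite -!size_poly_eq0 size_tofrac. Qed.

Lemma clear_denominators (P : {poly ratfun k}) :
  exists D (Q : {poly {poly k}}), D != 0 /\ (tofrac D)%:P * P = map_poly (@tofrac _) Q.
Proof.
have [D D0 [c cD]] := common_denominator (fun i : 'I_(size P) => P`_i).
exists D, (\poly_(i < size P) if insub i is Some j then c j else 0); split=> //.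
apply/polyP => i; rewrite coefCM coef_map coef_poly; case: ltnP => [lt_i|le_i] /=.
  by rewrite insubT /= mulrC (cD (Ordinal lt_i)).
by rewrite nth_default // mulr0 rmorph0.
Qed.

Lemma bev_tofrac (iota : {rmorphism ratfun k -> κ(X)}) (Q : {poly {poly k}}) :
  (forall p, iota (tofrac p) = pev u p) -> (map_poly iota (fr Q)).[v] = bev u v Q.
Proof.
move=> iotaP; rewrite bevE -map_poly_comp; congr (_.[v]); apply: eq_map_poly => p /=.
by rewrite iotaP.
Qed.

(** [relation_size] for coefficients in k(u) rather than k[u]. *)
Lemma rational_relation_size (iota : {rmorphism ratfun k -> κ(X)}) (P : {poly ratfun k}) :
  (forall p, iota (tofrac p) = pev u p) -> P != 0 -> (map_poly iota P).[v] = 0 ->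
  (N < size P)%N.
Proof.
move=> iotaP P0 eP; have [D [Q [D0 DP]]] := clear_denominators P.
have fD0 : tofrac D != 0 by rewrite tofrac_eq0.
have sP : size Q = size P by rewrite -size_tofrac -DP mul_polyC size_scale.
rewrite -sP; apply: (relation_size u_tr degu gen_uv).
  by rewrite -size_poly_eq0 sP size_poly_eq0.
by rewrite -(bev_tofrac _ iotaP) -DP rmorphM hornerM eP mulr0.
Qed.

(** Among the relations of least degree in x, take one whose leading coefficient
has least degree in u.  It is primitive, because dividing it by a common factor
would lower that degree, and irreducible over k(u), because one of two factors
would be a relation of smaller degree in x. *)
Lemma height_poly_exists : exists f, height_poly u v f.
Proof.
pose rel f := [/\ f != 0, bev u v f = 0 & (size f <= N.+1)%N].
pose S s := `[< exists2 f, rel f & size (lead_coef f) = s >].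
have [f1 rf1] := small_relation u_tr degu v.
have S1 : S (size (lead_coef f1)) by apply/asboolP; exists f1.
have [s /asboolP[f [f0 ef sf] fs] s_min] := ex_minnP (ex_intro S _ S1).
have lf0 : lead_coef f != 0 by rewrite lead_coef_eq0.
pose c := (lead_coef (lead_coef f))^-1.
have c0 : c != 0 by rewrite invr_eq0 lead_coef_eq0.
have cP0 : c%:P != 0 :> {poly k} by rewrite polyC_eq0.
have [iota [_ iotaP _]] := ratfun_embedding u_tr.
pose g := c%:P%:P * f.
have g0 : g != 0 by rewrite mulf_neq0 // !polyC_eq0.
have sg : size g = size f by rewrite size_Cmul.
have eg : bev u v g = 0 by rewrite rmorphM ef mulr0.
have evF Q : (map_poly iota (fr Q)).[v] = bev u v Q by apply: bev_tofrac.
exists g; split.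
- split; first by rewrite size_tofrac (leq_ltn_trans N0) // (relation_size u_tr degu gen_uv).
  move=> d sd dg; rewrite -dvdp_size_eqp //.
  have sFg : (size (fr g) <= N.+1)%N by rewrite size_tofrac sg.
  have Fg0 : fr g != 0 by rewrite tofrac_poly_eq0.
  have /dvdpP[e] := dg; rewrite -/(fr g) => eE.
  have d0 : d != 0 by apply: contra_neq Fg0 => d0; rewrite eE d0 mulr0.
  have e0 : e != 0 by apply: contra_neq Fg0 => e0; rewrite eE e0 mul0r.
  have := evF g; rewrite eg eE rmorphM hornerM => /eqP.
  rewrite mulf_eq0 => /orP[/eqP ee|/eqP ed].
    have Ne := rational_relation_size iotaP e0 ee.
    case/eqP: sd; apply/eqP; rewrite eqn_leq size_poly_gt0 d0 andbT.
    have := leq_trans sFg Ne; rewrite eE size_mul // -subn1 leq_subLR addnC.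
    by rewrite leq_add2r.
  have Nd := rational_relation_size iotaP d0 ed.
  rewrite -eE eqn_leq; apply/andP; split; first exact: dvdp_leq Fg0 dg.
  exact: leq_trans sFg Nd.
- by rewrite -[RHS]eg bevE.
- move=> d dg.
  have d0 : d != 0.
    apply: contra_neq g0 => d0; apply/polyP => i; rewrite coef0; apply/eqP.
    by have := dg i; rewrite d0 dvd0p.
  pose g' := \poly_(i < size g) (g`_i %/ d).
  have gE : g = d%:P * g'.
    apply/polyP => i; rewrite [RHS]coefCM coef_poly; case: ltnP => [_|wi].
      by rewrite mulrC divpK.
    by rewrite nth_default // mulr0.
  have g'0 : g' != 0 by apply: contra_neq g0 => g'0; rewrite gE g'0 mulr0.
  have eg' : bev u v g' = 0.
    by apply: (mulfI (u_tr d0)); rewrite mulr0 -[RHS]eg gE rmorphM bevC.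
  have : (s <= size (lead_coef g'))%N.
    apply: s_min; apply/asboolP; exists g' => //; split=> //.
    by rewrite (leq_trans (size_poly _ _)) // sg.
  have <- : size (lead_coef g) = s by rewrite lead_coefM lead_coefC size_Cmul.
  rewrite gE lead_coefM lead_coefC size_mul ?lead_coef_eq0 // -subn1 leq_subLR.
  by rewrite leq_add2r => sd; apply/eqP; rewrite eqn_leq sd size_poly_gt0.
- by rewrite /g lead_coefM lead_coefC monicE lead_coefM lead_coefC mulVf // lead_coef_eq0.
Qed.

(** Over k(u) an irreducible f that shares the root v with Q divides Q; then
clear denominators and apply Gauss's lemma. *)
Lemma height_poly_divides f Q : height_poly u v f -> bev u v Q = 0 ->
  exists w, Q = f * w.
Proof.
move=> [irr ef prim _] eQ; rewrite -bevE in ef.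
have [iota [_ iotaP _]] := ratfun_embedding u_tr.
have evF P : (map_poly iota (fr P)).[v] = bev u v P by apply: bev_tofrac.
have /dvdpP[E EE] : fr f %| fr Q.
  have sg : size (gcdp (fr f) (fr Q)) != 1%N.
    apply/negP => /Bezout_eq1_coprimepP[[a b] /= ab].
    have /eqP := congr1 (fun p => (map_poly iota p).[v]) ab.
    rewrite rmorph1 hornerC rmorphD !rmorphM hornerD !hornerM !evF ef eQ !mulr0 addr0.
    by rewrite eq_sym oner_eq0.
  by rewrite -(eqp_dvdl _ (irr.2 _ sg (dvdp_gcdl _ _))) dvdp_gcdr.
have [D [w [D0 Dw]]] := clear_denominators E.
apply: (primitive_divides (w := w) prim D0).
apply: (map_inj_poly (@fraction_inj _)); first exact: rmorph0.
by rewrite !rmorphM /= map_polyC /= -/(fr Q) EE mulrA Dw mulrC.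
Qed.

(** f divides the relations provided by [small_relation] for u over k(v) and for
v over k(u), and [relation_size] bounds its degrees from below. *)
Lemma height_degrees f : height_poly u v f -> size f = N.+1 /\ deg_u f = n.
Proof.
move=> hf; have [irr ef _ _] := hf; rewrite -bevE in ef.
have f0 : f != 0 by rewrite -tofrac_poly_eq0 irredp_neq0.
split.
  apply/eqP; rewrite eqn_leq (relation_size u_tr degu gen_uv) // andbT.
  have [Q [Q0 eQ sQ]] := small_relation u_tr degu v.
  have [w Qw] := height_poly_divides hf eQ.
  have w0 : w != 0 by apply: contra_neq Q0 => w0; rewrite Qw w0 mulr0.
  apply: leq_trans sQ; rewrite Qw size_mul // -subn1 -addnBA ?size_poly_gt0 //.
  exact: leq_addr.
have sY : sizeY f = n.+1.
  apply/eqP; rewrite sizeYE eqn_leq (relation_size v_tr degv gen_vu); last 2 first.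
  - by rewrite swapXY_eq0.
  - by rewrite bev_swapXY.
  rewrite andbT; have [Q [Q0 eQ sQ]] := small_relation v_tr degv u.
  have [|w Qw] := @height_poly_divides f (swapXY Q) hf; first by rewrite bev_swapXY.
  have w0 : w != 0 by apply: contra_neq Q0 => w0; apply/eqP; rewrite -swapXY_eq0 Qw w0 mulr0.
  apply: leq_trans sQ; rewrite -[Q]swapXYK Qw rmorphM size_mul ?swapXY_eq0 //.
  by rewrite -subn1 -addnBA ?size_poly_gt0 ?swapXY_eq0 ?leq_addr.
have Is : (0 < #|'I_(size f)|)%N by rewrite card_ord size_poly_gt0.
apply/eqP; rewrite eqn_leq; apply/andP; split.
  apply/bigmax_leqP => i _; rewrite -ltnS -sY.
  by case: (size _) (max_size_coefXY f i) => //=; rewrite sY.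
have [i0 eqi] := eq_bigmax (fun i : 'I_(size f) => size f`_i) Is.
by rewrite -[n]/(n.+1.-1) -sY /sizeY eqi (bigmax_sup i0).
Qed.

Lemma height_value : height u v = n%:R / N%:R.
Proof.
have [f hf] := height_poly_exists.
rewrite /height; have [|sf df] := @height_degrees (xget 0 [set f | height_poly u v f]).
  by apply: (@xgetI _ _ [set f | height_poly u v f] f).
by rewrite df /deg_x sf.
Qed.

End Height.

(** * Rational points of the curve *)

(** An element of the maximal ideal that is algebraic over k is 0, by
[pev_neq0].  Apply this to x minus its residue, or to the inverse of x if x has
a pole. *)
Lemma algebraic_constant (k K : fieldType) (cst : {rmorphism k -> K}) (O : set K) x :
  rational_local_ring cst O -> (O x \/ max_ideal O x^-1) ->
  algebraicOver cst x -> exists c, x = cst c.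
Proof.
move=> LO Ox alg_x.
have m_alg y : max_ideal O y -> algebraicOver cst y -> y = 0.
  move=> my [p p0 /rootP]; rewrite -pevE => ep; apply: contrapT => /eqP y0.
  by have := pev_neq0 LO my y0 p0; rewrite ep eqxx.
case: Ox => [Ox|mx].
  have [c mc] := local_residue LO Ox; exists c; apply/eqP; rewrite -subr_eq0.
  by apply/eqP/m_alg => //; apply: algebraic_sub => //; apply: algebraic_id.
exists 0; rewrite rmorph0; apply: invr_inj; rewrite invr0.
by apply: m_alg => //; apply: algebraic_inv.
Qed.

Section Curve.
Variables (k : finFieldType) (X : curve k) (u v : κ(X)).
Local Notation pev := (pev (cst X)).
Local Notation bev := (bev (cst X)).

Lemma point_local O : rational_points X O -> rational_local_ring (cst X) O.
Proof.
move=> [+ res]; have [r [m [a [_ ->]]]] := curve_finite_type X.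
by case=> i _ SO; apply: Spec_local SO res.
Qed.

Lemma point_fraction O : points (c := X) O ->
  forall z, exists x y, [/\ O x, O y, y != 0 & z = x / y].
Proof.
have [r [m [a [aff ->]]]] := curve_finite_type X => -[i _ SO] z.
have [gena _] := aff i; have : gen_field (cst X) (a i) z by rewrite gena.
case=> p [s [s0 ->]]; exists (mev (cst X) (a i) p), (mev (cst X) (a i) s).
by split=> //; apply: (Spec_gen_alg SO); [exists p | exists s].
Qed.

Lemma smooth_point_dvr N O : smooth_curve X -> rational_points X O ->
  vanishes_at u O -> u != 0 -> function_degree u N -> rational_dvr (cst X) O.
Proof.
move=> smX RO mu u0 degu; have LO := point_local RO; have [PO _] := RO.
have [d [a [G [s [SO G0 J]]]]] := smX _ PO.
have [t mt tP] := Jacobian_uniformizer LO SO G0 J.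
apply: (uniformizer_dvr LO (t := t)); last exact: point_fraction PO.
apply: (principal_uniformizer LO tP mt mu u0) => y.
have u_tr p : p != 0 -> pev u p != 0 by apply: (pev_neq0 LO mu u0).
by have [Q [Q0 eQ _]] := small_relation u_tr degu y; exists Q.
Qed.

Section Splitting.
Variables (N : nat) (O : 'I_N -> set κ(X)).
Hypothesis HO : forall i, rational_dvr (cst X) (O i).
Hypothesis O_inj : injective O.
Hypothesis mu : forall i, max_ideal (O i) u.
Hypothesis u0 : u != 0.
Hypothesis u_tr : forall p, p != 0 -> pev u p != 0.
Hypothesis degu : function_degree u N.
Hypothesis N0 : (0 < N)%N.
Hypothesis gen : gen_field (cst X) [tuple u; v] = setT.

(** If two embeddings agree at v, they agree on k(u,v), so they have the same
inverse image of k[[u]], which is the local ring of the point. *)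
Lemma point_embeddings : exists sigma : 'I_N -> {rmorphism κ(X) -> laurent k},
  (forall i p, sigma i (pev u p) = tofrac (powser_of_poly p)) /\
  injective (fun i => sigma i v).
Proof.
have unr := full_fiber_unramified HO mu u0 O_inj
  (fun e => polynomial_dependence u_tr degu e (ltnSn N)).
have /choice[sigma sP] : forall i, exists s : {rmorphism κ(X) -> laurent k},
    (forall p, s (pev u p) = tofrac (powser_of_poly p)) /\
    (forall x, O i x <-> exists f, s x = tofrac f).
  move=> i; apply: Laurent_expansion => //; apply: (unramified_uniformizer (HO i)) => //.
  exact: unr.
exists sigma; split=> [i|i j e]; first by case: (sP i).
have bevE P : sigma i (bev u v P) = sigma j (bev u v P).
  rewrite (bev_sum _ _ _ (leqnn _)) !rmorph_sum; apply: eq_bigr => l _.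
  by rewrite !rmorphM !rmorphXn (sP i).1 (sP j).1 e.
apply: O_inj; apply/seteqP.
have sE x : sigma i x = sigma j x.
  have [|P [S [_ ->]]] := @gen_field2_fraction _ _ (cst X) u v x; first by rewrite gen.
  by rewrite !fmorph_div !bevE.
by split=> x; rewrite ((sP i).2 x) ((sP j).2 x) sE.
Qed.

(** The relation of [small_relation] has size N+1 by [relation_size], so it is
minimal, and the N embeddings provide N distinct roots of it. *)
Lemma splits_totally : totally_adic u v.
Proof.
have gen_uv z : exists p s, bev u v s != 0 /\ z = bev u v p / bev u v s.
  by apply: gen_field2_fraction; rewrite gen.
have [sigma [sigmaP sigma_inj]] := point_embeddings.
have [iota [iotaE iotaP EP]] := ratfun_embedding u_tr.
have [Q [Q0 eQ sQ]] := small_relation u_tr degu v.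
pose Fr := map_poly (@tofrac {poly k}) Q.
have sFr : size Fr = N.+1.
  by apply/eqP; rewrite size_tofrac eqn_leq sQ (relation_size u_tr degu gen_uv).
have Fr0 : Fr != 0 by rewrite -size_poly_eq0 sFr.
have lF : lead_coef Fr != 0 by rewrite lead_coef_eq0.
have lF0 : (lead_coef Fr)^-1 != 0 by rewrite invr_eq0.
pose mup := (lead_coef Fr)^-1 *: Fr.
have smu : size mup = N.+1 by rewrite size_scale.
have mu_monic : mup \is monic by rewrite monicE lead_coefZ (mulVf lF) eqxx.
have emu : root (map_poly iota mup) v.
  by apply/rootP; rewrite map_polyZ hornerZ (bev_tofrac v Q iotaP) eQ mulr0.
have atE : map_poly (ratfun_at u) mup = map_poly iota mup.
  apply: eq_map_poly => z; rewrite iotaE; congr (_ / _); exact: esym (pevE _ _ _).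
exists mup.
  rewrite atE; split=> //.
  - by rewrite map_monic.
  - by move=> i; apply/EP; exists mup`_i; rewrite coef_map.
  move=> r Er r0 er; rewrite size_map_poly smu.
  have /choice[c cE] : forall i, exists z, r`_i = iota z by move=> i; apply/EP.
  pose r' := \poly_(i < size r) c i.
  have rE : r = map_poly iota r'.
    apply/polyP => i; rewrite coef_map coef_poly; case: ltnP => [_|ri]; first exact: cE.
    rewrite nth_default //; exact: esym (rmorph0 iota).
  rewrite rE size_map_poly; apply: (rational_relation_size u_tr degu gen iotaP (v := v)).
    by apply: contra_neq r0 => r'0; rewrite rE r'0 rmorph0.
  by rewrite -rE; apply/rootP.
pose phi : {rmorphism {poly k} -> laurent k} := @tofrac (powser k) \o @powser_of_poly k.
have phi_inj : injective phi.
  by move=> p r /fraction_inj/powser_of_poly_inj.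
have [lam [lamE lamP]] := fraction_extension phi_inj.
have sigma_iota i z : sigma i (iota z) = lam z.
  by rewrite [z]frac_repr !fmorph_div !iotaP !lamP !sigmaP.
exists [seq sigma i v | i <- enum 'I_N].
have -> : map_poly (@laurent_of_ratfun k) mup = map_poly lam mup.
  by apply: eq_map_poly => z; rewrite lamE.
rewrite [LHS](@all_roots_prod_XsubC _ _ [seq sigma i v | i <- enum 'I_N]).
- by rewrite lead_coef_map (monicP mu_monic) rmorph1 scale1r.
- by rewrite size_map_poly smu size_map size_enum_ord.
- apply/allP => _ /mapP[i _ ->]; have := rmorph_root (sigma i) emu.
  by rewrite -map_poly_comp (eq_map_poly (sigma_iota i)).
- by rewrite uniq_rootsE map_inj_uniq ?enum_uniq.
Qed.

End Splitting.
End Curve.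

Theorem theorem3p8 (q : nat) (F : finFieldType) (n : nat) (X : curve F)
    (u v : κ(X)) :
  #|F| = q ->
  (1 <= n)%N ->
  smooth_curve X -> proper_curve X -> geometrically_irreducible X ->
  separable_function u -> separable_function v ->
  (rational_points X #= `I_(n * (q + 1)))%card ->
  function_degree u (n * (q + 1)) -> function_degree v n ->
  gen_field (cst X) [tuple u; v] = setT ->
  (forall O, rational_points X O -> vanishes_at u O) ->
  [/\ totally_adic u v,
      ext_degree (gen_field (cst X) [tuple u]) (gen_field (cst X) [tuple u; v])
        (n * (q + 1)) &
      height u v = 1 / (q + 1)%:R].
Proof.
move=> _ n0 smX _ _ [u_nc _] [v_nc _] cardX degu degv gen van.
set N := (n * (q + 1))%N in cardX degu *.
have N0 : (0 < N)%N by rewrite muln_gt0 n0 addn1.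
have u0 : u != 0 by apply/eqP => u0; apply: u_nc; exists 0; rewrite rmorph0.
have [O [O_inj RO]] : exists O : 'I_N -> set κ(X),
    injective O /\ forall i, rational_points X (O i).
  have /card_set_bijP[f [f1 f2 _]] := card_esym cardX.
  exists (fun i : 'I_N => f i); split=> [i j e|i]; last exact/f1/ltn_ord.
  by apply/val_inj/f2 => //=; rewrite inE /=; apply: ltn_ord.
have mu i : max_ideal (O i) u := van _ (RO i).
have HO i : rational_dvr (cst X) (O i) := smooth_point_dvr smX (RO i) (mu i) u0 degu.
have HO0 := HO (Ordinal N0); have LO0 := dvr_local HO0.
have u_tr p : p != 0 -> pev (cst X) u p != 0 by apply: (pev_neq0 LO0 (mu _) u0).
have v_tr p : p != 0 -> pev (cst X) v p != 0.
  (* A nonzero p with p(v) = 0 would make v a constant. *)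
  move=> p0; apply/eqP => ep; apply: v_nc.
  apply: (algebraic_constant LO0 (dvr_valuation HO0 v)).
  by exists p => //; apply/rootP; rewrite -pevE.
split.
- exact: (splits_totally HO O_inj).
- by rewrite gen.
rewrite (height_value N0 u_tr v_tr degu degv gen) /N natrM div1r.
by rewrite invfM mulrA mulfV ?mul1r // Num.Theory.pnatr_eq0 -lt0n.
Qed.
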